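(* Let the kernel $K$ be either a PDK of order $m$ or an EDK with parameters $\gamma>0$, $p\ge1$. Let $s^\dagger=n^{\frac{1}{2m+1}}$, $r^\dagger_{n,\lambda}=n^{-\frac{2m}{2m+1}}$, $\delta_n=n^{-\frac{2}{2m-1}}$ in the PDK case, and $s^\dagger=(\log n)^{1/p}$, $r^\dagger_{n,\lambda}=(\log n)^{1/p}n^{-1}$, $\delta_n=(\log n)^{-2/p}$ in the EDK case. Suppose $s=o(s^\dagger)$, and let $\lambda$ be a smoothing parameter with $s\ge ds_\lambda$ as in Assumption A2(a). Then there exists an $s\times n$ random matrix $S$ satisfying Assumption A2 such that, with probability greater than $1-e^{-cn\delta_n}-e^{-c_1s}-e^{-c_2s_\lambda}$, $$\sup_{f\in\mathcal{B}}\|\widehat f_R-f\|_n^2\gg r^\dagger_{n,\lambda},$$ where $c$ is a constant independent of $n$, and $c_1,c_2\in(0,\infty]$ are the constants in Assumption A2(b). Here $\mathcal{B}=\{f\in\mathcal{H}:\|f\|_{\mathcal{H}}\le C\}$ for a constant $C$, and $\widehat f_R$ is computed from data with true regression function $f$.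
   Context: Model: $y_i=f(x_i)+\epsilon_i$, $i=1,\dots,n$, where $x_1,\dots,x_n$ are i.i.d. from a distribution $P_X$ on $\mathcal{X}\subseteq\mathbb{R}^d$ ($d\ge1$ fixed), $\epsilon_i$ are i.i.d. $N(0,1)$ and independent of $(x_1,\dots,x_n)$ and $S$, and $f\in\mathcal{H}$. Kernel: $\mathcal{H}\subset L^2(P_X)$ is an RKHS with inner product $\langle\cdot,\cdot\rangle_{\mathcal{H}}$ and reproducing kernel $K(x,x')=\sum_{i=1}^\infty\mu_i\phi_i(x)\phi_i(x')$, with ordered eigenvalues $\mu_1\ge\mu_2\ge\cdots\ge0$, where $\{\phi_i\}$ is a basis of $L^2(P_X)$ with $\langle\phi_i,\phi_j\rangle_{L^2(P_X)}=\delta_{ij}$ and $\langle\phi_i,\phi_j\rangle_{\mathcal{H}}=\delta_{ij}/\mu_i$. Assumption A1 (standing): $\sup_{i\ge1}\|\phi_i\|_{\sup}<\infty$ and $\sup_{k\ge1}\frac{\sum_{i=k+1}^\infty\mu_i}{k\mu_k}<\infty$. PDK (polynomial decay kernel) of order $m$: $\mu_i\asymp i^{-2m}$. EDK (exponential decay kernel): $\mu_i\asymp\exp(-\gamma i^p)$. Estimator: $\boldsymbol{K}=[n^{-1}K(x_i,x_j)]_{1\le i,j\le n}$, $\boldsymbol{y}=(y_1,\dots,y_n)^\top$; for an $s\times n$ real random matrix $S$, $\widehat\beta=\frac1n(S\boldsymbol{K}^2S^\top+\lambda S\boldsymbol{K}S^\top)^{-1}S\boldsymbol{K}\boldsymbol{y}$,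 $\widehat f_R(\cdot)=\sum_{i=1}^n(S^\top\widehat\beta)_iK(\cdot,x_i)$. $\|g\|_n^2=\frac1n\sum_{i=1}^ng(x_i)^2$. Let $\boldsymbol{K}=UDU^\top$, $UU^\top=I_n$, $D=\mathrm{diag}(\widehat\mu_1,\dots,\widehat\mu_n)$, $\widehat\mu_1\ge\cdots\ge\widehat\mu_n\ge0$. Let $\widehat s_\lambda=\min\{i:\widehat\mu_i\le\lambda\}-1$ and $s_\lambda=\min\{i:\mu_i\le\lambda\}-1$. Write $U=(U_1,U_2)$ with $U_1$ the first $\widehat s_\lambda$ columns, and $D_2=\mathrm{diag}(\widehat\mu_{\widehat s_\lambda+1},\dots,\widehat\mu_n)$. $S$ is $\boldsymbol{K}$-satisfiable if there is a constant $c>0$ with $\|(SU_1)^\top SU_1-I_{\widehat s_\lambda}\|_{\mathrm{op}}\le1/2$ and $\|SU_2D_2^{1/2}\|_{\mathrm{op}}\le c\lambda^{1/2}$. An event $\mathcal{E}$ is of $(a,b)$-type, $a,b\in(0,\infty]$, if $P(P(\mathcal{E}\mid x_1,\dots,x_n)\ge1-e^{-a})\ge1-e^{-b}$. Assumption A2: (a) $s\ge ds_\lambda$ for a sufficiently large constant $d>0$; (b) there exist $c_1,c_2\in(0,\infty]$ such that the event ''$S$ is $\boldsymbol{K}$-satisfiable'' is of $(c_1s,c_2s_\lambda)$-type. $a_n\gg b_n$ means $a_n/b_n\to\infty$ as $n\to\infty$. *)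

(* Defs.v *)
From HB Require Import structures.
From mathcomp Require Import all_boot all_order all_algebra.
From mathcomp Require Import all_classical all_reals all_analysis.
Set Implicit Arguments.
Unset Strict Implicit.
Unset Printing Implicit Defensive.
Import Order.TTheory GRing.Theory Num.Theory.
Import numFieldNormedType.Exports.

Local Open Scope classical_set_scope.
Local Open Scope ring_scope.

(* Eigenvalues and eigenfunctions are indexed from 0: mu i and phi i stand for
   the (i+1)-st ones.  Functions on the domain D, a subset of T, are represented
   by their extension by zero to T, so that equality of functions on D is
   equality of terms. *)

Section RKHS.
Context {R : realType} {T : Type}.
Implicit Types (D : set T) (H : set (T -> R)) (K : T -> T -> R).
Implicit Types ip : (T -> R) -> (T -> R) -> R.

Definition hnorm ip (f : T -> R) : R := Num.sqrt (ip f f).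

Record rkhs D H ip K : Prop := Rkhs {
  rkhs_dom : forall f, H f -> forall x, ~ D x -> f x = 0;
  rkhs_0 : H 0;
  rkhs_lin : forall a f g, H f -> H g -> H (a *: f + g);
  rkhs_ipC : forall f g, H f -> H g -> ip f g = ip g f;
  rkhs_ip_lin : forall a f g h, H f -> H g -> H h ->
    ip (a *: f + g) h = a * ip f h + ip g h;
  rkhs_ip_ge0 : forall f, H f -> 0 <= ip f f;
  rkhs_ip_eq0 : forall f, H f -> ip f f = 0 -> f = 0;
  rkhs_complete : forall u : nat -> T -> R, (forall k, H (u k)) ->
    (forall e, 0 < e -> exists N, forall j k, (N <= j)%N -> (N <= k)%N ->
       hnorm ip (u j - u k) < e) ->
    exists2 f, H f & hnorm ip (u k - f) @[k --> \oo] --> (0 : R);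
  rkhs_kernel : forall x, D x -> H (K x);
  rkhs_repr : forall f, H f -> forall x, D x -> ip f (K x) = f x }.

Definition hball H ip (C : R) : set (T -> R) :=
  [set f | H f /\ hnorm ip f <= C].

End RKHS.

Section Eigensystem.
Context {R : realType} {dT : measure_display} {T : measurableType dT}.
Variable PX : probability T R.
Implicit Types (mu : nat -> R) (phi : nat -> T -> R).

Definition L2ip (f g : T -> R) : R := \int[PX]_x (f x * g x).

Definition L2_orthonormal_basis phi : Prop :=
  [/\ forall i, phi i \in Lfun PX 2%:E,
      forall i j, L2ip (phi i) (phi j) = (i == j)%:R
    & forall g, g \in Lfun PX 2%:E -> exists a : nat -> R,
        Lnorm PX 2%:E (EFin \o (g - \sum_(i < N) a i *: phi i)) @[N --> \oo]
          --> 0%E].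

Record eigensystem (D : set T) (H : set (T -> R)) ip (K : T -> T -> R)
    mu phi : Prop := Eigensystem {
  eigen_ge0 : forall i, 0 <= mu i;
  eigen_ordered : forall i j, (i <= j)%N -> mu j <= mu i;
  eigen_dom : forall i x, ~ D x -> phi i x = 0;
  eigen_basis : L2_orthonormal_basis phi;
  eigen_mem : forall i, 0 < mu i -> H (phi i);
  eigen_ip : forall i j, 0 < mu i -> 0 < mu j ->
    ip (phi i) (phi j) = (i == j)%:R / mu i;
  eigen_kernel : forall x x',
    series (fun i => mu i * phi i x * phi i x') @ \oo --> K x x' }.

(* finite supremum of the sup-norms, and finite supremum over k >= 1 of the
   k-th eigenvalue tail divided by k times the k-th eigenvalue *)
Definition assumption_A1 mu phi : Prop :=
  (exists M : R, forall i x, `|phi i x| <= M) /\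
  (exists M : R, forall k : nat,
    (\sum_(k.+1 <= i <oo) (mu i)%:E <= (M * (k.+1%:R * mu k))%:E)%E).

End Eigensystem.

Inductive decay (R : Type) : Type := PDK of R | EDK of R & R.

Section Decay.
Context {R : realType}.
Implicit Types k : decay R.

Definition decay_valid k : Prop :=
  match k with PDK m => True | EDK gamma p => 0 < gamma /\ 1 <= p end.

Definition decay_rate k (i : nat) : R :=
  match k with
  | PDK m => i%:R `^ (- (2 * m))
  | EDK gamma p => expR (- (gamma * i%:R `^ p))
  end.

Definition has_decay k (mu : nat -> R) : Prop :=
  exists c C : R, [/\ 0 < c, 0 < C &
    forall i, c * decay_rate k i.+1 <= mu i <= C * decay_rate k i.+1].

Definition s_dagger k (n : nat) : R :=
  match k with
  | PDK m => n%:R `^ (2 * m + 1)^-1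
  | EDK gamma p => ln n%:R `^ p^-1
  end.

Definition r_dagger k (n : nat) : R :=
  match k with
  | PDK m => n%:R `^ (- (2 * m / (2 * m + 1)))
  | EDK gamma p => ln n%:R `^ p^-1 * n%:R^-1
  end.

Definition delta_ k (n : nat) : R :=
  match k with
  | PDK m => n%:R `^ (- (2 / (2 * m - 1)))
  | EDK gamma p => ln n%:R `^ (- (2 / p))
  end.

Definition much_larger (a b : nat -> R) : Prop :=
  (a n / b n) @[n --> \oo] --> +oo.

(* With eigenvalues indexed from 0 the shift by -1 in
   min {i >= 1 : mu_i <= lambda} - 1 disappears. *)
Definition s_lambda (mu : nat -> R) (lam : R) : nat :=
  xget 0%N [set k | mu k <= lam /\ forall j, (j < k)%N -> lam < mu j].

End Decay.

Section Sketch.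
Context {R : realType}.

Definition l2norm n (v : 'cV[R]_n) : R := Num.sqrt (\sum_i v i 0 ^+ 2).

Definition opnorm p q (A : 'M[R]_(p, q)) : R :=
  sup [set l2norm (A *m v) | v in [set v : 'cV[R]_q | l2norm v <= 1]].

Definition spectral_decomposition n (A U : 'M[R]_n) (muh : 'rV[R]_n) : Prop :=
  [/\ A = U *m diag_mx muh *m U^T, U *m U^T = 1%:M,
      forall i j : 'I_n, (i <= j)%N -> muh 0 j <= muh 0 i
    & forall i, 0 <= muh 0 i].

(* equal to n when all the empirical eigenvalues exceed lambda *)
Definition s_hat n (muh : 'rV[R]_n) (lam : R) : nat :=
  find (fun i => muh 0 i <= lam) (enum 'I_n).

Lemma s_hat_le n (muh : 'rV[R]_n) lam : (s_hat muh lam <= n)%N.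
Proof. by rewrite /s_hat (leq_trans (find_size _ _))// size_enum_ord. Qed.

Definition head_idx n (muh : 'rV[R]_n) lam (i : 'I_(s_hat muh lam)) : 'I_n :=
  widen_ord (s_hat_le muh lam) i.

Definition tail_idx n (muh : 'rV[R]_n) lam (i : 'I_(n - s_hat muh lam)) : 'I_n :=
  cast_ord (subnKC (s_hat_le muh lam)) (rshift (s_hat muh lam) i).

Definition satisfiable (c lam : R) n (A : 'M[R]_n) s (S : 'M[R]_(s, n)) : Prop :=
  exists (U : 'M[R]_n) (muh : 'rV[R]_n), spectral_decomposition A U muh /\
    let U1 := colsub (@head_idx n muh lam) U in
    let U2 := colsub (@tail_idx n muh lam) U in
    let sqrtD2 := diag_mx (\row_i Num.sqrt (muh 0 (@tail_idx n muh lam i))) in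
    opnorm ((S *m U1)^T *m (S *m U1) - 1%:M) <= 2^-1 /\
    opnorm (S *m U2 *m sqrtD2) <= c * Num.sqrt lam.

Section Estimator.
Context {T : Type} (K : T -> T -> R) (n : nat) (x : n.-tuple T).

Definition gram : 'M[R]_n :=
  \matrix_(i, j) (n%:R^-1 * K (tnth x i) (tnth x j)).

Definition normal_matrix s (lam : R) (S : 'M[R]_(s, n)) : 'M[R]_s :=
  S *m (gram *m gram) *m S^T + lam *: (S *m gram *m S^T).

(* invmx is the inverse only on unitmx: to be used with normal_matrix invertible *)
Definition beta_hat s (lam : R) (S : 'M[R]_(s, n)) (y : 'cV[R]_n) : 'cV[R]_s :=
  n%:R^-1 *: (invmx (normal_matrix lam S) *m S *m gram *m y).

Definition f_hat s (lam : R) (S : 'M[R]_(s, n)) (y : 'cV[R]_n) : T -> R :=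
  fun z => \sum_i (S^T *m beta_hat lam S y) i 0 * K z (tnth x i).

Definition empnorm2 (g : T -> R) : R := n%:R^-1 * \sum_i g (tnth x i) ^+ 2.

Definition responses (f : T -> R) (e : n.-tuple R) : 'cV[R]_n :=
  \col_i (f (tnth x i) + tnth e i).

Definition worst_risk (B : set (T -> R)) s (lam : R) (S : 'M[R]_(s, n))
    (e : n.-tuple R) : \bar R :=
  ereal_sup [set (empnorm2 (f_hat lam S (responses f e) - f))%:E | f in B].

End Estimator.
End Sketch.

Section Probability.
Context {R : realType} {d : measure_display} {Omega : measurableType d}.
Variable P : probability Omega R.

Definition independent d1 d2 (T1 : measurableType d1) (T2 : measurableType d2)
    (U : Omega -> T1) (V : Omega -> T2) : Prop :=
  forall A B, measurable A -> measurable B ->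
    P (U @^-1` A `&` V @^-1` B) = (P (U @^-1` A) * P (V @^-1` B))%E.

Definition iid d1 (T1 : measurableType d1) (Q : set T1 -> \bar R)
    (Z : nat -> {RV P >-> T1}) : Prop :=
  (forall i A, measurable A -> distribution P (Z i) A = Q A) /\
  (forall n (A : nat -> set T1), (forall i, measurable (A i)) ->
    P (\bigcap_(i < n) (Z i @^-1` A i)) = (\prod_(i < n) P (Z i @^-1` A i))%E).

Definition sample T1 (Z : nat -> Omega -> T1) n (w : Omega) : n.-tuple T1 :=
  [tuple Z i w | i < n].

(* g \o V is a version of the conditional probability of E given V *)
Definition conditional_probability d1 (T1 : measurableType d1)
    (V : Omega -> T1) (E : set Omega) (g : T1 -> R) : Prop :=
  measurable_fun setT g /\
  forall B, measurable B ->
    (\int[P]_(w in V @^-1` B) (g (V w))%:E = P (V @^-1` B `&` E))%E.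

(* The measure of a set is only meaningful for measurable sets, hence the inner
   measurable event F in the next two definitions; F can be E itself as soon as
   E is measurable. *)
Definition event_type d1 (T1 : measurableType d1) (V : Omega -> T1)
    (a b : \bar R) (E : set Omega) : Prop :=
  exists (F : set Omega) (g : T1 -> R),
    [/\ measurable F, F `<=` E, conditional_probability V F g &
        (1 - expeR (- b) <=
           P [set w | 1 - expeR (- a) <= (g (V w))%:E])%E].

Definition prob_gt (p : \bar R) (E : set Omega) : Prop :=
  exists F, [/\ measurable F, F `<=` E & (p < P F)%E].

Definition mx_tuple s n (A : 'M[R]_(s, n)) : s.-tuple (n.-tuple R) :=
  [tuple [tuple A i j | j < n] | i < s].

Context {dT : measure_display} {T : measurableType dT}.

Record regression_data (PX : probability T R)
    (X : nat -> {RV P >-> T}) (eps : nat -> {RV P >-> R}) : Prop :=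
  RegressionData {
    data_design : iid PX X;
    data_noise : iid (T1 := R) (normal_prob (0 : R) 1) eps;
    data_indep : forall n, independent (sample X n) (sample eps n) }.

Record random_sketch (X : nat -> Omega -> T) (eps : nat -> Omega -> R)
    n s (S : Omega -> 'M[R]_(s, n)) : Prop := RandomSketch {
  sketch_meas : forall i j, measurable_fun setT (fun w => S w i j);
  sketch_indep :
    independent (sample eps n) (fun w => (sample X n w, mx_tuple (S w))) }.

Record assumption_A2 (K : T -> T -> R) (mu : nat -> R)
    (X : nat -> Omega -> T) (dc : R) (c1 c2 : \bar R)
    (s : nat -> nat) (lam : nat -> R)
    (S : forall n, Omega -> 'M[R]_(s n, n)) : Prop := AssumptionA2 {
  A2_c1 : (0 < c1)%E;
  A2_c2 : (0 < c2)%E;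
  A2_size : forall n, (0 < n)%N -> dc * (s_lambda mu (lam n))%:R <= (s n)%:R;
  A2_satisfiable : exists2 c : R, 0 < c & forall n, (0 < n)%N ->
    event_type (sample X n)
      (c1 * (s n)%:R%:E) (c2 * (s_lambda mu (lam n))%:R%:E)
      [set w | satisfiable c (lam n) (gram K (sample X n w)) (S n w)] }.

End Probability.

(* Main.v *)
Require Import Defs.
From HB Require Import structures.
From mathcomp Require Import all_boot all_order all_algebra.
From mathcomp Require Import all_classical all_reals all_analysis.
From mathcomp Require Import measurable_realfun ring lra zify.
Import Order.TTheory GRing.Theory Num.Theory.
Import numFieldNormedType.Exports.
Local Open Scope classical_set_scope.
Local Open Scope ring_scope.
Set Implicit Arguments.
Unset Strict Implicit.
Unset Printing Implicit Defensive.

(** The lower bound is a matter of dimension.  On the sample points, the sketched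
    estimator takes its values in the range of [gram *m S^T], a space of
    dimension at most [s] that depends on the design but neither on the noise
    nor on the regression function.  Among the combinations of the first [s + 1]
    eigenfunctions there is a nonzero one whose sample values are orthogonal to
    that range; taken as the regression function it is not approximated at all,
    so that the risk is at least its own squared empirical norm.  If the
    empirical Gram matrix of these [s + 1] eigenfunctions is within 1/2 of the
    identity, then scaling the function to the boundary of the ball leaves an
    empirical squared norm of at least [C ^+ 2 / 2 * mu s] ([worst_risk_ge]), and
    the eigenvalue decay turns [s = o(s_dagger)] into a bound of larger order
    than [r_dagger] ([risk_rate]).

    The Gram matrix is that close to the identity except with probability
    [2 q^2 exp (- n / (b q^2))], [q = s + 1], by Hoeffding's inequality and a
    union bound ([good_design_prob]).  As [q] is of smaller order than
    [s_dagger], this is below [exp (- c n delta_n)]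
    ([failure_probability_small]).

    For the sketch, one would like the [s] leading eigenvectors of the empirical
    kernel matrix as rows.  The part of the kernel beyond the first [s_lambda]
    eigenfunctions has a trace of order [s_lambda * lam], the eigenfunctions
    being uniformly bounded; hence at most a constant multiple of [s_lambda]
    empirical eigenvalues exceed [lam / 4], whatever the design
    ([small_eigenvalues]), and the ideal sketch is satisfiable surely, not just
    with high probability.  So both constants of the satisfiability event can be
    taken infinite.  A random matrix also has to be a measurable function
    of the design.  The conditions required of the sketch hold with some slack
    for the ideal one, hence hold for a rational matrix nearby
    ([exists_good_sketch]); each of them defines a measurable set of designs, and
    the first rational matrix in an enumeration that satisfies them is a
    measurable choice ([exists_measurable_sketch]).

    If [s_lambda = 0] then the last exponential in the probability bound is 1:
    the bound is negative, and the satisfiability requirement is void as well. *)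

(** * Dot products and the spectral theorem for real symmetric matrices *)

Section DotProduct.
Context {R : realType}.

(** Scalar-valued, where [u^T *m v] would be a matrix of size one. *)
Definition dotc n (u v : 'cV[R]_n) : R := \sum_i u i 0 * v i 0.

Lemma dotcE n (u v : 'cV[R]_n) : dotc u v = (u^T *m v) 0 0.
Proof. by rewrite mxE; apply: eq_bigr => i _; rewrite mxE. Qed.

Lemma dotcC n (u v : 'cV[R]_n) : dotc u v = dotc v u.
Proof. by apply: eq_bigr => i _; rewrite mulrC. Qed.

Lemma dotcDl n (u v w : 'cV[R]_n) : dotc (u + v) w = dotc u w + dotc v w.
Proof. by rewrite -big_split; apply: eq_bigr => i _; rewrite mxE mulrDl. Qed.

Lemma dotcZl n a (u w : 'cV[R]_n) : dotc (a *: u) w = a * dotc u w.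
Proof. by rewrite /dotc big_distrr; apply: eq_bigr => i _; rewrite mxE -mulrA. Qed.

Lemma dotcNl n (u w : 'cV[R]_n) : dotc (- u) w = - dotc u w.
Proof. by rewrite -scaleN1r dotcZl mulN1r. Qed.

Lemma dotcDr n (u v w : 'cV[R]_n) : dotc w (u + v) = dotc w u + dotc w v.
Proof. by rewrite !(dotcC w) dotcDl. Qed.

Lemma dotcZr n a (u w : 'cV[R]_n) : dotc w (a *: u) = a * dotc w u.
Proof. by rewrite !(dotcC w) dotcZl. Qed.

Lemma dotcNr n (u w : 'cV[R]_n) : dotc w (- u) = - dotc w u.
Proof. by rewrite !(dotcC w) dotcNl. Qed.

Lemma dotc0r n (u : 'cV[R]_n) : dotc u 0 = 0.
Proof. by rewrite -(scale0r 0) dotcZr mul0r. Qed.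

Definition dotc_lin := (dotcDl, dotcDr, dotcNl, dotcNr, dotcZl, dotcZr).

Lemma dotc_mull m n (A : 'M[R]_(m, n)) u v :
  dotc (A *m u) v = dotc u (A^T *m v).
Proof. by rewrite !dotcE trmx_mul mulmxA. Qed.

Lemma dotc_mulr m n (A : 'M[R]_(m, n)) u v :
  dotc u (A *m v) = dotc (A^T *m u) v.
Proof. by rewrite dotc_mull trmxK. Qed.

Lemma dotc_gram m n (A : 'M[R]_(m, n)) u :
  dotc (A *m u) (A *m u) = dotc u (A^T *m A *m u).
Proof. by rewrite dotc_mull mulmxA. Qed.

Lemma dotcc n (u : 'cV[R]_n) : dotc u u = \sum_i u i 0 ^+ 2.
Proof. by apply: eq_bigr => i _; rewrite expr2. Qed.

Lemma dotcc_ge0 n (u : 'cV[R]_n) : 0 <= dotc u u.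
Proof. by rewrite dotcc sumr_ge0// => i _; rewrite sqr_ge0. Qed.

Lemma dotcc_eq0 n (u : 'cV[R]_n) : (dotc u u == 0) = (u == 0).
Proof.
rewrite dotcc psumr_eq0; last by move=> i _; rewrite sqr_ge0.
apply/idP/eqP => [/allP u0|->]; last by apply/allP => i _; rewrite mxE expr0n eqxx.
apply/colP => i; rewrite mxE.
by have := u0 i (mem_index_enum _); rewrite sqrf_eq0 => /eqP.
Qed.

Lemma dotcc_gt0 n (u : 'cV[R]_n) : (0 < dotc u u) = (u != 0).
Proof. by rewrite lt_def dotcc_ge0 dotcc_eq0 andbT. Qed.

Lemma l2normE n (u : 'cV[R]_n) : l2norm u = Num.sqrt (dotc u u).
Proof. by rewrite dotcc. Qed.

Lemma dotc_diag n (d : 'rV[R]_n) (u : 'cV[R]_n) :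
  dotc u (diag_mx d *m u) = \sum_i d 0 i * u i 0 ^+ 2.
Proof.
by apply: eq_bigr => i _; rewrite mul_diag_mx mxE expr2; ring.
Qed.

Lemma dotc_orth n (U : 'M[R]_n) u v :
  U *m U^T = 1%:M -> dotc (U *m u) (U *m v) = dotc u v.
Proof. by move=> /mulmx1C UU; rewrite dotc_mull mulmxA UU mul1mx. Qed.

Lemma mulmx_eigen n (A U : 'M[R]_n) d (u : 'cV[R]_n) :
  A = U *m diag_mx d *m U^T -> U *m U^T = 1%:M ->
  A *m (U *m u) = U *m (diag_mx d *m u).
Proof.
by move=> -> /mulmx1C UU; rewrite -!mulmxA (mulmxA U^T) UU mul1mx.
Qed.

Lemma dotc_eigen n (A U : 'M[R]_n) d (u : 'cV[R]_n) :
  A = U *m diag_mx d *m U^T -> U *m U^T = 1%:M ->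
  dotc (U *m u) (A *m (U *m u)) = \sum_i d 0 i * u i 0 ^+ 2.
Proof.
by move=> AE UU; rewrite (mulmx_eigen _ AE UU) (dotc_orth _ _ UU) dotc_diag.
Qed.

Lemma sum_delta n (f : 'I_n -> R) k :
  \sum_i f i * (delta_mx k 0 : 'cV[R]_n) i 0 ^+ 2 = f k.
Proof.
rewrite (bigD1 k)//= big1 => [|i ik]; last by rewrite mxE (negPf ik) expr0n mulr0.
by rewrite mxE !eqxx expr1n mulr1 addr0.
Qed.

Lemma dotc_delta n (k : 'I_n) :
  dotc (delta_mx k 0) (delta_mx k 0 : 'cV[R]_n) = 1.
Proof. by rewrite dotcc -(sum_delta (fun=> 1) k); apply: eq_bigr => i _; rewrite mul1r. Qed.

(** Perturbing [v] in the direction [A *m v] would otherwise make the form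
    negative to first order. *)
Lemma psd_form_kernel n (A : 'M[R]_n) v : A^T = A ->
  (forall w, 0 <= dotc w (A *m w)) -> dotc v (A *m v) = 0 -> A *m v = 0.
Proof.
move=> As A0 v0; set w := A *m v.
apply/eqP; rewrite -dotcc_eq0; apply/eqP/le_anti; rewrite dotcc_ge0 andbT leNgt.
apply/negP => w_gt0; set a := dotc w w in w_gt0; set b := dotc w (A *m w).
have b0 : 0 <= b by exact: A0.
have b1 : 0 < b + 1 by lra.
pose e := a / (b + 1).
have := A0 (v - e *: w).
rewrite mulmxBr -scalemxAr !dotc_lin v0 -/w -/b -/a.
have -> : dotc v (A *m w) = a by rewrite dotc_mulr As.
have -> : 0 - e * a + (- (e * a) + - (e * - (e * b))) = - (e * (a + a / (b + 1))).
  by rewrite /e; field; rewrite gt_eqF.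
rewrite oppr_ge0 => /le_gtF; rewrite mulr_gt0 ?divr_gt0//.
by rewrite ltr_pwDl// divr_ge0// ltW.
Qed.

End DotProduct.

Section Spectral.
Context {R : realType}.

Lemma cvg_sumr I (r : seq I) T (F : set_system T) {FF : Filter F}
    (f : I -> T -> R) (a : I -> R) :
  (forall i, f i x @[x --> F] --> a i) ->
  \sum_(i <- r) f i x @[x --> F] --> \sum_(i <- r) a i.
Proof. by move=> fa; apply: cvg_big => //; exact: add_continuous. Qed.

(** The form attains a maximum on the unit sphere by compactness; at a maximizer
    the positive semidefinite form of [mu%:M - A] vanishes, so that this matrix
    annihilates it. *)
Lemma max_eigenvector n (A : 'M[R]_n.+1) : A^T = A ->
  exists v mu, [/\ dotc v v = 1, A *m v = mu *: v &
    forall w, dotc w (A *m w) <= mu * dotc w w].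
Proof.
move=> As.
pose f (u : 'rV[R]_n.+1) := dotc u^T (A *m u^T).
pose N (u : 'rV[R]_n.+1) := dotc u^T u^T.
have cf (B : 'M[R]_n.+1) : continuous (fun u : 'rV[R]_n.+1 => dotc u^T (B *m u^T)).
  move=> u; apply: (@cvg_sumr _ _ _ _ (nbhs_filter u)) => i.
  under eq_fun do rewrite !mxE.
  rewrite !mxE; apply: cvgM; first exact: coord_continuous.
  apply: (@cvg_sumr _ _ _ _ (nbhs_filter u)) => j.
  under eq_fun do rewrite mxE; rewrite mxE.
  by apply: cvgM; [exact: cvg_cst|exact: coord_continuous].
have cN : continuous N.
  suff -> : N = (fun u => dotc u^T (1%:M *m u^T)) by exact: cf.
  by apply/funext => u; rewrite mul1mx.
pose S := [set u | N u = 1].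
have S0 : S !=set0.
  exists (delta_mx 0 0); rewrite /S /N /= dotcc (bigD1 0)//= big1 => [|i i0].
    by rewrite !mxE !eqxx addr0 expr1n.
  by rewrite !mxE (negPf i0) andbF expr0n.
have cS : compact S.
  apply: bounded_closed_compact; last first.
    by rewrite (_ : S = N @^-1` [set 1])//; apply: preimage_closed => //; exact: closed_eq.
  exists 1; split; first exact: num_real.
  move=> M M1 u Su; rewrite /Num.norm/= mx_normrE; apply/bigmax_leP; split.
    by rewrite (le_trans ler01)// ltW.
  move=> [i j] _ /=; rewrite ord1 (le_trans _ (ltW M1))//.
  rewrite -(@ler_pXn2r _ 2)// ?nnegrE// expr1n real_normK ?num_real//.
  rewrite -Su /N dotcc (bigD1 j)//= mxE lerDl sumr_ge0// => k _; exact: sqr_ge0.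
have [c] := EVT_max_rV S0 cS (@continuous_subspaceT _ _ S f (cf A)).
rewrite inE => Sc fmax.
have hmax w : dotc w (A *m w) <= f c * dotc w w.
  have [->|w0] := eqVneq w 0; first by rewrite mulmx0 !dotc0r mulr0.
  rewrite -dotcc_gt0 in w0.
  have n0 : Num.sqrt (dotc w w) != 0 by rewrite gt_eqF// sqrtr_gt0.
  have := fmax ((Num.sqrt (dotc w w))^-1 *: w^T).
  rewrite inE /S/= /N /f linearZ/= trmxK -scalemxAr !dotc_lin mulrA -invfM.
  rewrite -expr2 sqr_sqrtr ?(ltW w0)// mulVf ?gt_eqF// => /(_ erefl).
  by rewrite mulrA -invfM -expr2 sqr_sqrtr ?(ltW w0)// mulrC ler_pdivrMr.
exists c^T, (f c); split=> //.
have : (f c *: 1%:M - A) *m c^T = 0.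
  apply: psd_form_kernel.
  - by rewrite linearB/= linearZ/= trmx1 As.
  - move=> w; rewrite mulmxBl -scalemxAl mul1mx !dotc_lin subr_ge0; exact: hmax.
  - by rewrite mulmxBl -scalemxAl mul1mx !dotc_lin -/(N c) Sc mulr1 subrr.
by rewrite mulmxBl -scalemxAl mul1mx => /eqP; rewrite subr_eq0 => /eqP.
Qed.

(** The reflection that exchanges [v] and the first basis vector, unless they
    coincide. *)
Lemma orthogonal_first_column n (v : 'cV[R]_n.+1) : dotc v v = 1 ->
  exists Q : 'M[R]_n.+1, Q *m Q^T = 1%:M /\ Q *m delta_mx 0 0 = v.
Proof.
move=> v1; pose e : 'cV[R]_n.+1 := delta_mx 0 0; pose w := e - v.
have e1 : dotc e e = 1.
  rewrite dotcc (bigD1 0)//= big1 => [|i i0]; last by rewrite mxE (negPf i0) expr0n.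
  by rewrite !mxE !eqxx addr0 expr1n.
have [w0|w0] := eqVneq w 0.
  exists 1%:M; rewrite trmx1 mulmx1 mul1mx; split=> //.
  by apply/eqP; rewrite -subr_eq0; apply/eqP.
have := w0; rewrite -dotcc_gt0 => ww.
have wwE : dotc w w = 2 * dotc w e.
  by rewrite /w !dotc_lin e1 v1 (dotcC e); ring.
pose Q : 'M[R]_n.+1 := 1%:M - (2 / dotc w w) *: (w *m w^T).
have OE u : Q *m u = u - (2 / dotc w w * dotc w u) *: w.
  rewrite mulmxBl mul1mx -scalemxAl -mulmxA; congr (_ - _).
  have -> : w^T *m u = (dotc w u)%:M.
    by apply/matrixP => i j; rewrite !ord1 -dotcE mxE eqxx.
  by rewrite mul_mx_scalar scalerA.
exists Q; split; last first.
  rewrite OE -/e wwE mulrAC divff ?mulf_neq0//; last first.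
  - by apply: contraTneq ww => we; rewrite wwE we mulr0 ltxx.
  by rewrite scale1r /w opprB addrCA subrr addr0.
have Os : Q^T = Q.
  by rewrite linearB/= trmx1 linearZ/= trmx_mul trmxK.
rewrite Os {1}/Q mulmxBl mul1mx -scalemxAl -mulmxA.
have -> : w^T *m Q = - w^T.
  rewrite -{1}Os -trmx_mul OE.
  have -> : 2 / dotc w w * dotc w w = 2 by rewrite divfK// gt_eqF.
  by rewrite linearB/= linearZ/= scaler_nat mulr2n opprD addNKr.
by rewrite mulmxN scalerN opprK subrK.
Qed.

(** Deflation: in an orthonormal basis that starts with a maximizing eigenvector
    the matrix is block diagonal.  The eigenvalue split off bounds the form, so
    putting it in front keeps the list sorted. *)
Lemma symmetric_spectral n (A : 'M[R]_n) : A^T = A ->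
  exists U muh, [/\ A = U *m diag_mx muh *m U^T, U *m U^T = 1%:M &
    forall i j : 'I_n, (i <= j)%N -> muh 0 j <= muh 0 i].
Proof.
elim: n A => [|n IHn] A As.
  by exists 1%:M, 0; split; [apply/matrixP => -[]|rewrite trmx1 mulmx1|case].
have [v [mu [v1 Av hmax]]] := max_eigenvector As.
have [Q [OO Oe]] := orthogonal_first_column v1.
have OO' := mulmx1C OO.
pose A' : 'M[R]_(1 + n) := Q^T *m A *m Q.
have A's : A'^T = A' by rewrite /A' !trmx_mul trmxK As mulmxA.
have A'e : A' *m (delta_mx 0 0 : 'cV_n.+1) = mu *: (delta_mx 0 0 : 'cV_n.+1).
  rewrite /A' -!mulmxA Oe Av -Oe -!scalemxAr mulmxA.
  by rewrite OO' mul1mx.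
have AE : A = Q *m A' *m Q^T.
  by rewrite /A' !mulmxA OO mul1mx -mulmxA OO mulmx1.
clearbody A'.
have A'col i : A' i 0 = mu *+ (i == 0).
  have := congr1 (fun M : 'cV_n.+1 => M i 0) A'e.
  rewrite -colE mxE => ->; rewrite !mxE eqxx andbT.
  by case: (i == 0); rewrite /= ?mulr1 ?mulr0.
have A'E : A' = block_mx mu%:M 0 0 (drsubmx A').
  rewrite -[LHS]submxK; congr block_mx.
  - by apply/matrixP => i j; rewrite !ord1 !mxE !lshift0 A'col !eqxx.
  - apply/matrixP => i j; rewrite !ord1 -A's !mxE lshift0 A'col.
    by rewrite -val_eqE.
  - by apply/matrixP => i j; rewrite !ord1 !mxE lshift0 A'col -val_eqE.
have Bs : (drsubmx A')^T = drsubmx A' by rewrite trmx_drsub A's.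
have [U' [muh' [BE UU' sorted']]] := IHn _ Bs.
pose V : 'M[R]_(1 + n) := block_mx 1%:M 0 0 U'.
have VV : V *m V^T = 1%:M.
  rewrite /V tr_block_mx mulmx_block trmx1 !trmx0 !mul0mx !mulmx0 !mulmx1.
  by rewrite !addr0 !add0r UU' -scalar_mx_block.
pose muh : 'rV[R]_(1 + n) := row_mx mu%:M muh'.
have A'V : A' = V *m diag_mx muh *m V^T.
  rewrite A'E /V /muh diag_mx_row tr_block_mx !mulmx_block trmx1 !trmx0.
  rewrite ?(mul0mx, mulmx0, mul1mx, mulmx1, addr0, add0r) -BE; congr block_mx.
  by apply/matrixP => i j; rewrite !ord1 !mxE.
have AQV : A = (Q *m V) *m diag_mx muh *m (Q *m V)^T.
  by rewrite {1}AE A'V trmx_mul !mulmxA.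
have QVQV : (Q *m V) *m (Q *m V)^T = 1%:M.
  by rewrite trmx_mul mulmxA -(mulmxA Q) VV mulmx1.
exists (Q *m V), muh; split=> //.
move=> i j.
have muh_le k : muh 0 k <= mu.
  have := hmax (Q *m V *m delta_mx k 0).
  by rewrite (dotc_eigen _ AQV QVQV) sum_delta (dotc_orth _ _ QVQV) dotc_delta mulr1.
have muhr l : muh 0 (rshift 1 l) = muh' 0 l by rewrite row_mxEr.
have muh0 : muh 0 (lshift n 0) = mu by rewrite row_mxEl mxE eqxx.
case: (@split_ordP 1 n i) => i' ->; first by rewrite [i']ord1 muh0.
case: (@split_ordP 1 n j) => j' ->; first by rewrite /= ord1.
by rewrite !muhr /= leq_add2l; exact: sorted'.
Qed.

Lemma psd_spectral n (A : 'M[R]_n) : A^T = A ->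
  (forall w, 0 <= dotc w (A *m w)) ->
  exists U muh, spectral_decomposition A U muh.
Proof.
move=> As A0; have [U [muh [AE UU sorted]]] := symmetric_spectral As.
exists U, muh; split=> // i.
by have := A0 (U *m delta_mx i 0); rewrite (dotc_eigen _ AE UU) sum_delta.
Qed.

End Spectral.

(** * Eigenvalues, traces and quadratic forms *)

Section LinearAlgebra.
Context {R : realType}.

Lemma exists_kernel_vector m q (B : 'M[R]_(m, q)) : (m < q)%N ->
  exists2 a : 'cV[R]_q, a != 0 & B *m a = 0.
Proof.
move=> mq; have : kermx B^T != 0.
  rewrite kermx_eq0 /row_free; apply: contraTneq mq => <-.
  by rewrite -leqNgt mxrank_tr rank_leq_row.
case/rowV0Pn => v /sub_kermxP vB v0.
exists v^T; first by rewrite -trmx0 (inj_eq trmx_inj).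
by rewrite -[B]trmxK -trmx_mul vB trmx0.
Qed.

(** A unit vector killed by [B] and orthogonal to the columns found so far
    exists as long as the number of constraints is less than [q]. *)
Lemma exists_orthonormal_kernel p k q (B : 'M[R]_(k, q)) : (k + p <= q)%N ->
  exists V : 'M[R]_(q, p), V^T *m V = 1%:M /\ B *m V = 0.
Proof.
elim: p => [|p IHp] kpq.
  exists 0; split; first by apply/matrixP => -[].
  by apply/matrixP => i [].
have [|V [VV BV]] := IHp; first by rewrite (leq_trans _ kpq)// leq_add2l.
have [|a a0] := exists_kernel_vector (col_mx B V^T).
  by rewrite -addnS.
rewrite mul_col_mx -[0]vsubmxK => /eq_col_mx[]; rewrite !linear0 => Ba Va.
pose z := (Num.sqrt (dotc a a))^-1 *: a.
have zz : z^T *m z = 1%:M.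
  apply/matrixP => i j; rewrite !ord1 -dotcE !dotc_lin mulrA -invfM -expr2.
  by rewrite sqr_sqrtr ?dotcc_ge0// mulVf ?dotcc_eq0// mxE.
have Vz : V^T *m z = 0 by rewrite -scalemxAr Va scaler0.
rewrite -addn1.
exists (row_mx V z); split; last first.
  by rewrite mul_mx_row BV -scalemxAr Ba scaler0 row_mx0.
rewrite tr_row_mx mul_col_row VV zz Vz (scalar_mx_block p 1).
by rewrite -[z^T *m V]trmxK trmx_mul trmxK Vz trmx0.
Qed.

Lemma mxtr_gram m n (A : 'M[R]_(m, n)) : \tr (A^T *m A) = \sum_j \sum_i A i j ^+ 2.
Proof.
apply: eq_bigr => j _; rewrite !mxE; apply: eq_bigr => i _.
by rewrite mxE expr2.
Qed.

Lemma mxtr_col m n (A : 'M[R]_m) (V : 'M[R]_(m, n)) :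
  \tr (V^T *m A *m V) = \sum_j dotc (col j V) (A *m col j V).
Proof.
apply: eq_bigr => j _; rewrite -mulmxA mxE !colE.
by rewrite mulmxA -colE; apply: eq_bigr => i _; rewrite -colE !mxE.
Qed.

(** Counting dimensions, the kernel of [F] contains [i + 1 - k] orthonormal
    vectors from the span of the eigenvectors [0 .. i], and on each of them the
    form is at least [muh 0 i]. *)
Lemma eigenvalue_le_trace n k (A U : 'M[R]_n) muh (F : 'M[R]_(k, n)) tau :
  spectral_decomposition A U muh ->
  (forall p (V : 'M[R]_(n, p)), V^T *m V = 1%:M -> F *m V = 0 ->
    \tr (V^T *m A *m V) <= tau) ->
  forall i : 'I_n, (k <= i)%N -> (i.+1 - k)%:R * muh 0 i <= tau.
Proof.
move=> [AE UU sorted _] Ftau i ki.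
pose f (j : 'I_(n - i.+1)) : 'I_n := cast_ord (subnKC (ltn_ord i)) (rshift i.+1 j).
have [|V [VV]] := @exists_orthonormal_kernel (i.+1 - k) _ _ (col_mx F (rowsub f U^T)).
  by have := ltn_ord i; lia.
rewrite mul_col_mx -[0]vsubmxK => /eq_col_mx[]; rewrite !linear0 => FV fUV.
apply: le_trans (Ftau _ V VV FV).
pose Z := U^T *m V.
have VE : V = U *m Z by rewrite mulmxA UU mul1mx.
have ZZ : Z^T *m Z = 1%:M by rewrite trmx_mul trmxK mulmxA -(mulmxA V^T) UU mulmx1.
have Z0 (l : 'I_n) j : (i < l)%N -> Z l j = 0.
  move=> il; have lt : (l - i.+1 < n - i.+1)%N by have := ltn_ord l; lia.
  have -> : l = f (Ordinal lt) by apply/val_inj; rewrite /= subnKC.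
  have := congr1 (fun M : 'M[R]_(_, _) => M (Ordinal lt) j) fUV.
  by rewrite mul_rowsub_mx !mxE.
have -> : \tr (V^T *m A *m V) = \sum_j \sum_l muh 0 l * Z l j ^+ 2.
  rewrite mxtr_col; apply: eq_bigr => j _.
  rewrite VE colE -mulmxA -colE (dotc_eigen _ AE UU).
  by apply: eq_bigr => l _; rewrite mxE.
have -> : (i.+1 - k)%:R * muh 0 i = \sum_j \sum_l muh 0 i * Z l j ^+ 2.
  under eq_bigr do rewrite -mulr_sumr.
  by rewrite -mulr_sumr -mxtr_gram ZZ mxtrace1 mulrC.
apply: ler_sum => j _; apply: ler_sum => l _.
have [li|il] := leqP l i; last by rewrite Z0// expr0n !mulr0.
by rewrite ler_wpM2r ?sqr_ge0 ?sorted.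
Qed.

(** Each [`|v i * v j|] is at most half of [v i ^+ 2 + v j ^+ 2], and the factor
    [1 / n] pays for the [n] terms in which a given square occurs. *)
Lemma form_le_entries n (E : 'M[R]_n) e (v : 'cV[R]_n) :
  (forall i j, `|E i j| <= e / n%:R) -> `|dotc v (E *m v)| <= e * dotc v v.
Proof.
move=> Ee; case: n E v Ee => [|n] E v Ee.
  by rewrite /dotc !big_ord0 normr0 mulr0.
have -> : dotc v (E *m v) = \sum_i \sum_j v i 0 * (E i j * v j 0).
  by apply: eq_bigr => i _; rewrite mxE mulr_sumr.
have -> : e * dotc v v =
    \sum_(i < n.+1) \sum_(j < n.+1) e / n.+1%:R * ((v i 0 ^+ 2 + v j 0 ^+ 2) / 2).
  under eq_bigr do rewrite -mulr_sumr -mulr_suml big_split/= -dotcc.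
  rewrite -mulr_sumr -mulr_suml big_split/= sumr_const card_ord.
  under eq_bigr do rewrite sumr_const card_ord.
  rewrite sumrMnl -dotcc -(mulr_natr (dotc v v)).
  have : n.+1%:R != 0 :> R by rewrite pnatr_eq0.
  by move: (n.+1%:R) => m m0; field.
apply: le_trans (ler_norm_sum _ _ _) _; apply: ler_sum => i _.
apply: le_trans (ler_norm_sum _ _ _) _; apply: ler_sum => j _.
rewrite mulrCA normrM; apply: ler_pM => //.
rewrite ler_norml; apply/andP; split.
  have := sqr_ge0 (v i 0 + v j 0); nra.
have := sqr_ge0 (v i 0 - v j 0); nra.
Qed.

Lemma opnorm_le p q (A : 'M[R]_(p, q)) c : 0 <= c ->
  (forall v, dotc (A *m v) (A *m v) <= c ^+ 2 * dotc v v) -> opnorm A <= c.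
Proof.
move=> c0 Ac; apply: ge_sup.
  exists (l2norm (A *m 0)), 0 => //=.
  by rewrite l2normE dotc0r sqrtr0.
move=> _ [v /= v1 <-].
have {}v1 : dotc v v <= 1 by rewrite -ler_sqrt// sqrtr1 -l2normE.
rewrite l2normE -(ger0_norm c0) -sqrtr_sqr ler_wsqrtr// (le_trans (Ac v))//.
by rewrite ler_piMr ?sqr_ge0.
Qed.

(** Polarization bounds the bilinear form by the quadratic one. *)
Lemma symmetric_form_norm n (M : 'M[R]_n) c : 0 < c -> M^T = M ->
  (forall a, `|dotc a (M *m a)| <= c * dotc a a) ->
  forall a, dotc (M *m a) (M *m a) <= c ^+ 2 * dotc a a.
Proof.
move=> c0 Ms Mc a; set b := M *m a.
(* This scaling balances the two squared norms that polarization produces. *)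
pose t := c^-1.
have := Mc (a + t *: b); have := Mc (a - t *: b).
rewrite !ler_norml => /andP[h1 _] /andP[_ h2].
move: h1 h2.
have h : dotc a (M *m b) = dotc b b by rewrite dotc_mulr Ms.
rewrite mulmxBr mulmxDr -scalemxAr -/b !dotc_lin h (dotcC b a).
set x := dotc a b; set y := dotc b b; set z := dotc b (M *m b); set w := dotc a a.
have tc : t * c = 1 by rewrite mulVf ?gt_eqF.
move=> h1 h2.
have : 4 * (t * y) <= 2 * (c * w) + 2 * (c * t) * (t * y) by nra.
rewrite (_ : 2 * (c * t) = 2) => [h3|]; last by rewrite (mulrC c) tc mulr1.
have : t * y <= c * w by nra.
by rewrite -(ler_pM2l c0) mulrA (mulrC c t) tc mul1r; nra.
Qed.

End LinearAlgebra.

(** * Good sketches: satisfiability and existence *)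

Section GoodSketch.
Context {R : realType}.

(** A sufficient condition for satisfiability that does not mention a spectral
    decomposition, so that it is visibly measurable in [A] and stable under small
    changes of [S].  The second bound is a disguised lower bound on [S]: for [v]
    in the span of the eigenvectors with eigenvalue above [lam], take [A *m w = v];
    then the last term is at most a quarter of the squared norm of [v]. *)
Definition good_sketch n s (A : 'M[R]_n) (lam : R) (S : 'M[R]_(s, n)) : Prop :=
  (forall v, dotc (S *m v) (S *m v) <= 3 / 2 * dotc v v) /\
  (forall w, 0 <= dotc (S *m (A *m w)) (S *m (A *m w))
      - 3 / 4 * dotc (A *m w) (A *m w) + lam / 4 * dotc w (A *m w)).

Lemma colsub_orthonormal p n (U : 'M[R]_n) (f : 'I_p -> 'I_n) :
  injective f -> U *m U^T = 1%:M -> (colsub f U)^T *m colsub f U = 1%:M.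
Proof.
move=> finj /mulmx1C UU; apply/matrixP => i j.
have := congr1 (fun M : 'M[R]_n => M (f i) (f j)) UU.
rewrite !mxE (inj_eq finj) => <-; apply: eq_bigr => l _.
by rewrite !mxE.
Qed.

Lemma head_idx_gt n (muh : 'rV[R]_n) lam (i : 'I_(s_hat muh lam)) :
  lam < muh 0 (head_idx i).
Proof.
rewrite ltNge; apply/negbT.
have := before_find (head_idx i) (ltn_ord i).
rewrite (_ : nth _ _ _ = head_idx i)//.
by rewrite -[in LHS](_ : nat_of_ord (head_idx i) = i)// nth_ord_enum.
Qed.

Lemma tail_idx_le n (muh : 'rV[R]_n) lam (i : 'I_(n - s_hat muh lam)) :
  (forall i j : 'I_n, (i <= j)%N -> muh 0 j <= muh 0 i) ->
  muh 0 (tail_idx i) <= lam.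
Proof.
move=> sorted; have lt : (s_hat muh lam < n)%N by have := ltn_ord i; lia.
have /(nth_find (tail_idx i)) : has (fun i => muh 0 i <= lam) (enum 'I_n).
  by rewrite has_find size_enum_ord.
apply: le_trans; apply: sorted.
by rewrite -/(s_hat muh lam) nth_enum_ord//= leq_addr.
Qed.

(** On the leading eigenvectors the squared norm of [S *m v] is between 1/2 and
    3/2 times that of [v], which bounds a symmetric form and hence the operator
    norm.  On the others the upper bound alone suffices, since the eigenvalues
    there are at most [lam]. *)
Lemma good_sketch_satisfiable n s (A : 'M[R]_n) lam (S : 'M[R]_(s, n)) :
  0 < lam -> A^T = A -> (forall w, 0 <= dotc w (A *m w)) ->
  good_sketch A lam S -> satisfiable 2 lam A S.
Proof.
move=> lam0 As A0 [Sle Sge].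
have [U [muh Usp]] := psd_spectral As A0; exists U, muh; split => //=.
have [AE UU sorted muh0] := Usp.
have UU' := mulmx1C UU.
set U1 := colsub _ U; set U2 := colsub _ U.
have U1U1 : U1^T *m U1 = 1%:M.
  by apply: colsub_orthonormal => // i j /(congr1 val)/= ij; apply/val_inj.
have U2U2 : U2^T *m U2 = 1%:M.
  apply: colsub_orthonormal => // i j /(congr1 val)/= /eqP.
  by rewrite eqn_add2l => /eqP ij; apply/val_inj.
split; last first.
  apply: opnorm_le; first by rewrite mulr_ge0// sqrtr_ge0.
  move=> v; rewrite exprMn sqr_sqrtr ?(ltW lam0)// -!mulmxA.
  apply: le_trans (Sle _) _.
  rewrite dotc_mull (mulmxA U2^T) U2U2 mul1mx dotcc.
  rewrite (dotcc v) !mulr_sumr; apply: ler_sum => i _.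
  rewrite mul_diag_mx !mxE exprMn sqr_sqrtr//.
  have := tail_idx_le i sorted; have := sqr_ge0 (v i 0); have := muh0 (tail_idx i).
  by move: (muh _ _) (_ ^+ 2) => a b a0 b0 al; nra.
apply: opnorm_le; first by lra.
apply: symmetric_form_norm; first by lra.
  by rewrite linearB/= trmx1 trmx_mul trmxK.
move=> a; rewrite mulmxBl mul1mx dotcDr dotcNr -mulmxA dotc_mulr trmxK -mulmxA.
set v := U1 *m a.
have vv : dotc v v = dotc a a by rewrite /v dotc_mull mulmxA U1U1 mul1mx.
pose x := U^T *m v.
have vE : v = U *m x by rewrite mulmxA UU mul1mx.
have xx : dotc x x = dotc a a by rewrite -vv vE (dotc_orth _ _ UU).
have x0 i : muh 0 i <= lam -> x i 0 = 0.
  move=> il; rewrite /x /v mulmxA mxE big1// => j _.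
  have := congr1 (fun M : 'M[R]_n => M i (head_idx j)) UU'.
  rewrite !mxE; under eq_bigr do rewrite mxE.
  under [X in _ -> X * _ = _]eq_bigr do rewrite !mxE.
  move=> ->; case: eqP => [iE|_]; last by rewrite mul0r.
  by move: il; rewrite iE leNgt head_idx_gt.
(* The preimage of [v] under [A]; a zero eigenvalue meets a zero coordinate. *)
pose y : 'cV[R]_n := \col_i (x i 0 / muh 0 i).
have Dy : diag_mx muh *m y = x.
  apply/colP => i; rewrite mul_diag_mx mxE [y i 0]mxE.
  have [il|il] := leP (muh 0 i) lam; first by rewrite x0// mul0r mulr0.
  by rewrite mulrC divfK// gt_eqF// (lt_trans lam0).
have := Sge (U *m y); rewrite (mulmx_eigen _ AE UU) Dy -vE vv.
have : lam * dotc (U *m y) v <= dotc a a.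
  rewrite vE (dotc_orth _ _ UU) -xx !dotcc /dotc mulr_sumr; apply: ler_sum => i _.
  rewrite mxE; have [il|il] := leP (muh 0 i) lam.
    by rewrite x0// !(mul0r, mulr0) expr0n.
  have mi0 : 0 < muh 0 i by rewrite (lt_trans lam0).
  rewrite mulrAC -expr2 mulrCA ler_piMr ?sqr_ge0//.
  by rewrite ler_pdivrMr// mul1r ltW.
have := Sle v; rewrite vv ler_norml.
by move: (dotc (S *m v) _) (dotc (U *m y) v) => p q *; lra.
Qed.

Lemma rational_approx p q (B : 'M[R]_(p, q)) :
  exists Q : nat -> 'M[rat]_(p, q),
    forall i j, ratr (Q k i j) @[k --> \oo] --> B i j.
Proof.
have H (k : nat) i j : exists r : rat, ratr r \in `](B i j), (B i j + k.+1%:R^-1)[.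
  by apply: rat_in_itvoo; rewrite ltrDl invr_gt0.
pose Q k : 'M[rat]_(p, q) := \matrix_(i, j) projT1 (cid (H k i j)).
exists Q => i j.
apply: (@squeeze_cvgr _ _ _ _ (fun=> B i j) (fun k => B i j + k.+1%:R^-1)).
- near=> k; rewrite mxE; case: cid => r /=; rewrite in_itv/= => /andP[r1 r2].
  by rewrite !ltW.
- exact: cvg_cst.
- rewrite -[X in _ --> X]addr0; apply: cvgD; first exact: cvg_cst.
  exact: cvg_harmonic.
Unshelve. all: by end_near. Qed.

(** Entrywise, so that limits of scalar sums and products are all it takes. *)
Definition mx_cvg p q (B : nat -> 'M[R]_(p, q)) (C : 'M[R]_(p, q)) :=
  forall i j, B k i j @[k --> \oo] --> C i j.

Lemma mx_cvg_cst p q (C : 'M[R]_(p, q)) : mx_cvg (fun=> C) C.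
Proof. by move=> i j; exact: cvg_cst. Qed.

Lemma mx_cvgD p q (B B' : nat -> 'M[R]_(p, q)) C C' :
  mx_cvg B C -> mx_cvg B' C' -> mx_cvg (fun k => B k + B' k) (C + C').
Proof.
move=> BC BC' i j; rewrite mxE; under eq_fun do rewrite mxE.
exact: cvgD.
Qed.

Lemma mx_cvgZ p q (a : R) (B : nat -> 'M[R]_(p, q)) C :
  mx_cvg B C -> mx_cvg (fun k => a *: B k) (a *: C).
Proof.
move=> BC i j; rewrite mxE; under eq_fun do rewrite mxE.
by apply: cvgM; [exact: cvg_cst|].
Qed.

Lemma mx_cvgT p q (B : nat -> 'M[R]_(p, q)) C :
  mx_cvg B C -> mx_cvg (fun k => (B k)^T) C^T.
Proof. by move=> BC i j; rewrite mxE; under eq_fun do rewrite mxE; exact: BC. Qed.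

Lemma mx_cvgM p q r (B : nat -> 'M[R]_(p, q)) (B' : nat -> 'M[R]_(q, r)) C C' :
  mx_cvg B C -> mx_cvg B' C' -> mx_cvg (fun k => B k *m B' k) (C *m C').
Proof.
move=> BC BC' i j; rewrite mxE; under eq_fun do rewrite mxE.
by apply: cvg_sumr => l; exact: cvgM.
Qed.

Lemma mx_cvg_dotc p (B B' : nat -> 'cV[R]_p) C C' :
  mx_cvg B C -> mx_cvg B' C' -> dotc (B k) (B' k) @[k --> \oo] --> dotc C C'.
Proof.
by move=> BC BC'; apply: cvg_sumr => l; exact: cvgM.
Qed.

Lemma mx_cvg_det p (B : nat -> 'M[R]_p) C :
  mx_cvg B C -> \det (B k) @[k --> \oo] --> \det C.
Proof.
move=> BC; apply: cvg_sumr => s; apply: cvgM; first exact: cvg_cst.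
by apply: cvg_big => //; exact: mul_continuous.
Qed.

Lemma sum_eq_nat m (F : 'I_m -> R) (i : nat) :
  \sum_(j < m) (i == j)%:R * F j = oapp F 0 (insub i).
Proof.
case: insubP => [j _ ji|im] /=.
  rewrite (bigD1 j)//= -ji eqxx mul1r big1 ?addr0// => l lj.
  by rewrite eq_sym (inj_eq val_inj) (negPf lj) mul0r.
rewrite big1// => j _; case: eqP => [ij|_]; last by rewrite mul0r.
by rewrite ij ltn_ord in im.
Qed.

(** For the matrix [S0] whose rows are the [s] leading eigenvectors, the two
    bounds of a good sketch leave room for an error of a quarter of the squared
    norm, and the normal matrix is diagonal with positive entries as soon as the
    [s] leading eigenvalues are positive.  Rational matrices close to [S0] inherit
    both. *)
Lemma exists_good_sketch n s (A U : 'M[R]_n) muh lam :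
  0 < lam -> spectral_decomposition A U muh ->
  (forall i : 'I_n, (s <= i)%N -> muh 0 i <= lam / 4) ->
  exists S : 'M[rat]_(s, n), let S' : 'M[R]_(s, n) := map_mx ratr S in
    good_sketch A lam S' /\
    ((s <= n)%N -> (forall i : 'I_n, (i < s)%N -> 0 < muh 0 i) ->
      S' *m (A *m A) *m S'^T + lam *: (S' *m A *m S'^T) \in unitmx).
Proof.
move=> lam0 [AE UU _ muh0] small; have UU' := mulmx1C UU.
pose P : 'M[R]_(s, n) := \matrix_(i, j) (i == j :> nat)%:R.
pose S0 := P *m U^T.
have PP z : dotc (P *m z) (P *m z) = \sum_(j < n | (j < s)%N) z j 0 ^+ 2.
  rewrite dotcc.
  transitivity (\sum_(i < s) \sum_(j < n) (i == j :> nat)%:R * z j 0 ^+ 2).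
    apply: eq_bigr => i _; rewrite mxE; under eq_bigr do rewrite mxE.
    by rewrite !sum_eq_nat; case: insub => //=; rewrite expr0n.
  rewrite exchange_big [RHS]big_mkcond/=; apply: eq_bigr => j _.
  under eq_bigr do rewrite eq_sym.
  by rewrite sum_eq_nat; case: insubP => [i ->//|/negPf->].
have S0U z : dotc (S0 *m (U *m z)) (S0 *m (U *m z)) =
    \sum_(j < n | (j < s)%N) z j 0 ^+ 2.
  by rewrite -PP /S0 -mulmxA (mulmxA U^T) UU' mul1mx.
have [Q QS0] := rational_approx S0.
pose S k : 'M[R]_(s, n) := map_mx ratr (Q k).
have SS0 : mx_cvg S S0.
  by move=> i j; under eq_fun do rewrite mxE; exact: QS0.
pose N (T : 'M[R]_(s, n)) := T *m (A *m A) *m T^T + lam *: (T *m A *m T^T).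
have cdet : \det (N (S k)) @[k --> \oo] --> \det (N S0).
  apply/mx_cvg_det/mx_cvgD; last apply: mx_cvgZ.
    by apply/mx_cvgM; [apply/mx_cvgM => //; exact: mx_cvg_cst|exact: mx_cvgT].
  by apply/mx_cvgM; [apply/mx_cvgM => //; exact: mx_cvg_cst|exact: mx_cvgT].
have cgram : mx_cvg (fun k => (S k)^T *m S k) (S0^T *m S0).
  by apply: mx_cvgM => //; exact: mx_cvgT.
have mxB (M M' : 'M[R]_n) i j : (M - M') i j = M i j - M' i j by rewrite !mxE.
(* With [n.+1] in place of [n] the tolerance is positive for [n = 0] too. *)
pose e : R := 4^-1 / n.+1%:R.
have e0 : 0 < e by rewrite divr_gt0.
have near_gram : \forall k \near \oo, forall i j,
    `|((S k)^T *m S k - S0^T *m S0) i j| <= e.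
  apply: filter_forall => i; apply: filter_forall => j.
  have /cvgrPdist_le/(_ e e0) := cgram i j.
  by apply: filterS => k; rewrite mxB distrC.
have near_det : \forall k \near \oo,
    \det (N S0) != 0 -> \det (N (S k)) != 0.
  have [d0|d0] := eqVneq (\det (N S0)) 0; first by near=> k.
  have /cvgrPdist_lt/(_ `|\det (N S0)|) := cdet.
  rewrite normr_gt0 => /(_ d0); apply: filterS => k h _.
  by apply: contraTneq h => ->; rewrite subr0 ltxx.
have [k [gk dk]] := filter_ex (filterI near_gram near_det).
exists (Q k); rewrite -/(S k) => /=; rewrite -/(N (S k)).
have form v : `|dotc (S k *m v) (S k *m v) - dotc (S0 *m v) (S0 *m v)| <= 4^-1 * dotc v v.
  have -> : dotc (S k *m v) (S k *m v) - dotc (S0 *m v) (S0 *m v) =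
      dotc v (((S k)^T *m S k - S0^T *m S0) *m v).
    by rewrite mulmxBl dotcDr dotcNr (dotc_gram (S k)) (dotc_gram S0).
  apply: form_le_entries => i j; apply: le_trans (gk i j) _.
  have n0 : (0 < n)%N by rewrite (leq_ltn_trans _ (ltn_ord i)).
  by rewrite /e ler_wpM2l ?invr_ge0// lef_pV2 ?posrE ?ltr0n// ler_nat.
split; first split.
- move=> v; have := form v; rewrite ler_norml => /andP[_].
  have := S0U (U^T *m v); rewrite (mulmxA U) UU mul1mx => ->.
  have : \sum_(j < n | (j < s)%N) (U^T *m v) j 0 ^+ 2 <= dotc v v.
    rewrite -[leRHS](dotc_orth _ _ (_ : U^T *m U^T^T = _)) ?trmxK// dotcc.
    rewrite [leRHS](bigID (fun j : 'I_n => (j < s)%N))/= lerDl sumr_ge0// => j _.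
    exact: sqr_ge0.
  have := dotcc_ge0 v.
  by move: (dotc (S k *m v) _) (dotc v v) (\sum_(_ < _ | _) _) => a b c *; lra.
- move=> w; pose z := U^T *m w.
  have wE : w = U *m z by rewrite mulmxA UU mul1mx.
  have := form (A *m w); rewrite wE (dotc_eigen _ AE UU) (mulmx_eigen _ AE UU) S0U.
  rewrite (dotc_orth _ _ UU) ler_norml => /andP[+ _].
  move: (dotc (S k *m _) _) => a h.
  set y := diag_mx muh *m z in h *.
  suff : dotc y y <= \sum_(j < n | (j < s)%N) y j 0 ^+ 2 +
      lam / 4 * \sum_i muh 0 i * z i 0 ^+ 2.
    by move: h; move: (dotc y y) (\sum_(_ < _ | _) _) (\sum_i _) => *; lra.
  rewrite dotcc [in leRHS]big_mkcond mulr_sumr -big_split/=; apply: ler_sum => i _.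
  rewrite /y mul_diag_mx mxE; move: (z i 0) => zi.
  have l4 : 0 <= lam / 4 by rewrite divr_ge0// ltW.
  case: ltnP => [_|si]; first by rewrite lerDl mulr_ge0// mulr_ge0 ?sqr_ge0.
  rewrite add0r exprMn expr2 -mulrA; apply: ler_wpM2r; last exact: small.
  by rewrite mulr_ge0 ?sqr_ge0.
move=> sn pos; rewrite unitmxE unitfE; apply: dk.
pose d : 'rV[R]_s := \row_i (muh 0 (widen_ord sn i) ^+ 2 + lam * muh 0 (widen_ord sn i)).
have -> : N S0 = diag_mx d.
  pose V := colsub (widen_ord sn) U.
  have VV : V^T *m V = 1%:M.
    by apply: colsub_orthonormal => // i j /(congr1 val)/= ij; apply/val_inj.
  have S0V : S0 = V^T.
    apply/matrixP => i j; rewrite !mxE; under eq_bigr do rewrite 2!mxE.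
    rewrite sum_eq_nat insubT//=; first by rewrite (leq_trans (ltn_ord i)).
    by move=> lt; congr (U _ _); apply/val_inj.
  pose D := diag_mx (\row_i muh 0 (widen_ord sn i)).
  have AV : A *m V = V *m D.
    have AU : A *m U = U *m diag_mx muh by rewrite AE -!mulmxA UU' mulmx1.
    apply/matrixP => i j; have := congr1 (fun M : 'M[R]_n => M i (widen_ord sn j)) AU.
    rewrite /D !mul_mx_diag !mxE => <-.
    by apply: eq_bigr => l _; rewrite mxE.
  rewrite /N S0V trmxK -!mulmxA AV (mulmxA A) AV !mulmxA VV !mul1mx.
  by apply/matrixP => i j; rewrite /D mul_diag_mx !mxE; case: eqP => [->|_]; rewrite ?mulr1n ?mulr0n; ring.
rewrite det_diag prodf_seq_neq0; apply/allP => i _ /=.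
rewrite mxE gt_eqF// addr_gt0// ?mulr_gt0 ?exprn_gt0 ?pos//=.
Unshelve. all: by end_near. Qed.

End GoodSketch.

(** * The empirical kernel matrix *)

Section GramMatrix.
Context {R : realType} {T : Type}.
Variables (K : T -> T -> R) (mu : nat -> R) (phi : nat -> T -> R).
Hypothesis mu_ge0 : forall i, 0 <= mu i.
Hypothesis kernelE : forall x x',
  series (fun i => mu i * phi i x * phi i x') @ \oo --> K x x'.
Variables (n : nat) (x : n.-tuple T).

Definition feature i : 'cV[R]_n := \col_l phi i (tnth x l).

Lemma gram_sym : (gram K x)^T = gram K x.
Proof.
apply/matrixP => i j; rewrite !mxE; congr (_ * _).
have h : series (fun l => mu l * phi l (tnth x i) * phi l (tnth x j)) @ \oo -->
    K (tnth x j) (tnth x i).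
  rewrite (_ : (fun l => _) = fun l => mu l * phi l (tnth x j) * phi l (tnth x i)).
    exact: kernelE.
  by apply/funext => l; rewrite -!mulrA (mulrC (phi _ _)).
rewrite -(cvg_lim (@Rhausdorff R) h).
by rewrite (cvg_lim (@Rhausdorff R) (@kernelE (tnth x i) (tnth x j))).
Qed.

Lemma gram_form_cvg v :
  n%:R^-1 * \sum_(0 <= i < N) mu i * dotc (feature i) v ^+ 2 @[N --> \oo] -->
  dotc v (gram K x *m v).
Proof.
rewrite [X in _ --> X](_ : _ = n%:R^-1 *
    \sum_a \sum_b v a 0 * v b 0 * K (tnth x a) (tnth x b)); last first.
  rewrite mulr_sumr; apply: eq_bigr => a _; rewrite mxE !mulr_sumr.
  by apply: eq_bigr => b _; rewrite mxE; ring.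
apply: cvgM; first exact: cvg_cst.
rewrite [X in X @ _ --> _](_ : _ = fun N => \sum_a \sum_b v a 0 * v b 0 *
    series (fun i => mu i * phi i (tnth x a) * phi i (tnth x b)) N).
  apply: cvg_sumr => a; apply: cvg_sumr => b.
  by apply: cvgM; [exact: cvg_cst|exact: kernelE].
apply/funext => N; rewrite /series/=.
under [RHS]eq_bigr do under eq_bigr do rewrite mulr_sumr.
under [RHS]eq_bigr do rewrite exchange_big/=.
rewrite exchange_big/=; apply: eq_bigr => i _.
rewrite expr2 {1}/dotc mulr_suml mulr_sumr; apply: eq_bigr => a _.
rewrite /dotc !mulr_sumr; apply: eq_bigr => b _.
by rewrite !mxE; ring.
Qed.

Lemma gram_form_ge v i :
  n%:R^-1 * (mu i * dotc (feature i) v ^+ 2) <= dotc v (gram K x *m v).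
Proof.
apply: (cvgr_to_ge (@gram_form_cvg v)); near=> N.
apply: ler_wpM2l; first by rewrite invr_ge0.
have iN : (i < N)%N by near: N; exact: nbhs_infty_gt.
rewrite big_mkord (bigD1 (Ordinal iN))//= lerDl sumr_ge0// => j _.
by rewrite mulr_ge0 ?sqr_ge0.
Unshelve. all: by end_near. Qed.

Lemma gram_psd v : 0 <= dotc v (gram K x *m v).
Proof.
apply: le_trans (@gram_form_ge v 0%N).
by rewrite mulr_ge0 ?invr_ge0// mulr_ge0 ?sqr_ge0.
Qed.

(** Bessel's inequality bounds what the orthonormal columns of [V] can see of
    each feature, uniformly in the number of columns. *)
Lemma gram_trace_le k (M tau : R) p (V : 'M[R]_(n, p)) :
  (forall i z, `|phi i z| <= M) ->
  (forall N, \sum_(k <= i < N) mu i <= tau) ->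
  V^T *m V = 1%:M -> (forall i, (i < k)%N -> (feature i)^T *m V = 0) ->
  \tr (V^T *m gram K x *m V) <= M ^+ 2 * tau.
Proof.
move=> phiM mutau VV FV; rewrite mxtr_col.
have cv : \sum_j n%:R^-1 * (\sum_(0 <= i < N) mu i * dotc (feature i) (col j V) ^+ 2)
    @[N --> \oo] --> \sum_j dotc (col j V) (gram K x *m col j V).
  by apply: cvg_sumr => j; exact: gram_form_cvg.
apply: (cvgr_to_le cv); near=> N.
rewrite -mulr_sumr exchange_big/=.
have tau0 : 0 <= tau by have := mutau 0%N; rewrite big_geq.
have bessel i : \sum_j dotc (feature i) (col j V) ^+ 2 <= n%:R * M ^+ 2.
  pose f := feature i; pose c := V^T *m f.
  have -> : \sum_j dotc (feature i) (col j V) ^+ 2 = dotc c c.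
    rewrite dotcc; apply: eq_bigr => j _; congr (_ ^+ 2).
    by rewrite mxE; apply: eq_bigr => l _; rewrite !mxE mulrC.
  apply: (@le_trans _ _ (dotc f f)).
    have := dotcc_ge0 (f - V *m c).
    have h1 : dotc (V *m c) f = dotc c c by rewrite dotc_mull.
    have h2 : dotc (V *m c) (V *m c) = dotc c c by rewrite dotc_gram VV mul1mx.
    by rewrite !dotc_lin h2 (dotcC f (V *m c)) h1; lra.
  rewrite dotcc mulr_natl -[X in _ <= _ *+ X]card_ord -sumr_const; apply: ler_sum => l _.
  by rewrite mxE -(@real_normK _ (phi _ _)) ?num_real// lerXn2r ?nnegrE ?(le_trans _ (phiM i (tnth x l))).
have [n0|n0] := posnP n.
  have -> : n%:R^-1 = 0 :> R by rewrite n0 invr0.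
  by rewrite mul0r mulr_ge0// sqr_ge0.
rewrite ler_pdivrMl ?ltr0n//.
have [Nk|kN] := leqP N k.
  rewrite big_nat big1 => [|i /andP[_ iN]]; first by apply: mulr_ge0 => //; apply: mulr_ge0 => //; exact: sqr_ge0.
  rewrite big1// => j _.
  have := congr1 (fun W : 'M[R]_(_, _) => W 0 j) (FV i (leq_trans iN Nk)).
  rewrite !mxE => h; rewrite [dotc _ _](_ : _ = 0) ?expr0n ?mulr0// -h.
  by apply: eq_bigr => l _; rewrite !mxE.
rewrite (big_cat_nat _ (ltnW kN))//= big_nat big1 ?add0r => [|i /andP[_ ik]]; last first.
  rewrite big1// => j _.
  have := congr1 (fun W : 'M[R]_(_, _) => W 0 j) (FV i ik).
  rewrite !mxE => h; rewrite [dotc _ _](_ : _ = 0) ?expr0n ?mulr0// -h.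
  by apply: eq_bigr => l _; rewrite !mxE.
apply: (@le_trans _ _ (\sum_(k <= i < N) mu i * (n%:R * M ^+ 2))).
  by apply: ler_sum => i _; rewrite -mulr_sumr ler_wpM2l.
rewrite -mulr_suml mulrC -mulrA; apply: ler_wpM2l => //.
by apply: ler_wpM2l; rewrite ?sqr_ge0.
Unshelve. all: by end_near. Qed.

End GramMatrix.

(** * Designs with nearly orthonormal features *)

Section GoodDesign.
Context {R : realType} {T : Type}.

(** Entrywise closeness of the empirical Gram matrix to the identity makes
    concentration a union bound over scalar averages; the factor [1 / q] turns
    into 1/2 for the quadratic form. *)
Definition good_design (phi : nat -> T -> R) q n (x : n.-tuple T) : Prop :=
  forall i j : 'I_q,
    `|n%:R^-1 * \sum_l phi i (tnth x l) * phi j (tnth x l) - (i == j)%:R|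
      <= 2^-1 / q%:R.

Definition feature_mx (phi : nat -> T -> R) q n (x : n.-tuple T) : 'M[R]_(n, q) :=
  \matrix_(l, i) phi i (tnth x l).

Lemma good_design_form phi q n (x : n.-tuple T) (a : 'cV[R]_q) :
  good_design phi q x ->
  2^-1 * dotc a a <= n%:R^-1 * dotc (feature_mx phi q x *m a) (feature_mx phi q x *m a).
Proof.
move=> gd; set F := feature_mx phi q x.
have : `|dotc a ((n%:R^-1 *: (F^T *m F) - 1%:M) *m a)| <= 2^-1 * dotc a a.
  apply: form_le_entries => i j.
  have := gd i j; rewrite !mxE; congr (`| _ * _ - _| <= _).
  by apply: eq_bigr => l _; rewrite !mxE.
rewrite mulmxBl mul1mx -scalemxAl !dotc_lin -dotc_gram ler_norml => /andP[+ _].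
by move: (_ * dotc _ _) (dotc a a) => b c; lra.
Qed.

Variables (K : T -> T -> R) (mu : nat -> R) (phi : nat -> T -> R).
Hypothesis mu_gt0 : forall i, 0 < mu i.
Hypothesis kernelE : forall x x',
  series (fun i => mu i * phi i x * phi i x') @ \oo --> K x x'.

(** A kernel vector of the feature matrix would be a combination of features with
    vanishing empirical norm. *)
Lemma good_design_size q n (x : n.-tuple T) : good_design phi q x -> (q <= n)%N.
Proof.
move=> gd; rewrite leqNgt; apply/negP => nq.
have [a a0 Fa] := exists_kernel_vector (feature_mx phi q x) nq.
have := good_design_form a gd; rewrite Fa dotc0r.
by rewrite mulr0; move: a0; rewrite -dotcc_gt0; lra.
Qed.

(** A vanishing eigenvalue of index [i < q] leaves only [i] eigenvectors that are
    not orthogonal to all features; the [q] features would then be linearly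
    dependent on the sample. *)
Lemma good_design_eigenvalue q n (x : n.-tuple T) U muh :
  good_design phi q x -> spectral_decomposition (gram K x) U muh ->
  forall i : 'I_n, (i < q)%N -> 0 < muh 0 i.
Proof.
move=> gd [AE UU sorted muh0] i iq; rewrite lt_def muh0 andbT; apply/eqP => mi0.
pose f : 'I_i -> 'I_n := widen_ord (ltnW (ltn_ord i)).
set F := feature_mx phi q x.
have [a a0] := exists_kernel_vector (rowsub f U^T *m F) iq.
rewrite -mulmxA => Ua.
suff FA0 : F *m a = 0.
  have := good_design_form a gd; rewrite -/F FA0 dotc0r.
  by rewrite mulr0; move: a0; rewrite -dotcc_gt0; lra.
suff UFa : U^T *m (F *m a) = 0 by rewrite -[F]mul1mx -UU -!mulmxA UFa mulmx0.
apply/colP => l; rewrite [RHS]mxE.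
have [li|il] := ltnP l i.
  have := congr1 (fun M : 'M[R]_(_, _) => M (Ordinal li) 0) Ua.
  rewrite mul_rowsub_mx !mxE => h; rewrite -[RHS]h.
  by apply: eq_bigr => m _; congr (U^T _ _ * _); apply/val_inj.
have ml0 : muh 0 l = 0.
  by apply/le_anti; rewrite muh0 andbT -mi0 sorted.
have ul j : dotc (feature phi x j) (U *m delta_mx l 0) = 0.
  have := gram_form_ge (fun i => ltW (mu_gt0 i)) kernelE x (U *m delta_mx l 0) j.
  rewrite (dotc_eigen _ AE UU) sum_delta ml0.
  rewrite pmulr_rle0 ?invr_gt0 ?ltr0n ?(leq_ltn_trans _ (ltn_ord l))//.
  by rewrite pmulr_rle0// => h; apply/eqP; rewrite -sqrf_eq0 eq_le h sqr_ge0.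
rewrite mulmxA mxE big1// => j _.
rewrite [X in X * _](_ : _ = 0) ?mul0r// -[RHS](ul j) -colE mxE.
by apply: eq_bigr => m _; rewrite !mxE mulrC.
Qed.

End GoodDesign.

(** * Empirical eigenvalues beyond the sketch size *)

Section SketchExists.
Context {R : realType} {T : Type}.
Variables (K : T -> T -> R) (mu : nat -> R) (phi : nat -> T -> R) (M M1 : R).
Hypothesis mu_gt0 : forall i, 0 < mu i.
Hypothesis kernelE : forall x x',
  series (fun i => mu i * phi i x * phi i x') @ \oo --> K x x'.
Hypothesis phiM : forall i x, `|phi i x| <= M.
Hypothesis tailM : forall k : nat,
    (\sum_(k.+1 <= i <oo) (mu i)%:E <= (M1 * (k.+1%:R * mu k))%:E)%E.

Lemma s_lambda_le lam : (0 < s_lambda mu lam)%N -> mu (s_lambda mu lam) <= lam.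
Proof. by rewrite /s_lambda; case: xgetP => // k _ []. Qed.

Lemma tail_constant_ge0 : 0 <= M1.
Proof.
have := tailM 0; rewrite mul1r => h.
have : (0 <= (M1 * mu 0)%:E)%E.
  by apply: le_trans h; apply: nneseries_ge0 => i _ _; rewrite lee_fin ltW.
by rewrite lee_fin pmulr_lge0.
Qed.

Lemma tail_partial_sum k N : \sum_(k <= i < N) mu i <= (1 + M1 * k.+1%:R) * mu k.
Proof.
have M10 := tail_constant_ge0.
have [Nk|kN] := leqP N k.
  rewrite big_geq// mulr_ge0 ?(ltW (mu_gt0 _))// addr_ge0// mulr_ge0//.
rewrite big_ltn// mulrDl mul1r lerD2l.
have : (\sum_(k.+1 <= i < N) (mu i)%:E <= (M1 * (k.+1%:R * mu k))%:E)%E.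
  apply: le_trans (tailM k); apply: nneseries_lim_ge => i _ _.
  by rewrite lee_fin ltW.
by rewrite sumEFin lee_fin mulrA.
Qed.

(** With [c0 = M ^+ 2 * (1 + 2 * M1)] and [k = s_lambda mu lam], the kernel beyond
    the first [k] eigenfunctions has empirical trace at most [c0 * k * lam]; that
    is less than [lam / 4] times the [4 * c0 + 1] multiples of [k] that remain
    after [k] directions are set aside. *)
Definition sketch_factor : R := 4 * (M ^+ 2 * (1 + 2 * M1)) + 2.

Lemma sketch_factor_ge2 : 2 <= sketch_factor.
Proof.
rewrite /sketch_factor lerDr mulr_ge0// mulr_ge0 ?sqr_ge0//.
by have := tail_constant_ge0; lra.
Qed.

(** If [muh 0 i] exceeded [lam / 4] for some [i >= s], then a subspace of dimension
    [i + 1 - k] on which the first [k] eigenfunctions vanish would carry more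
    than the trace of the remaining kernel. *)
Lemma small_eigenvalues lam s n (x : n.-tuple T) U muh :
  0 < lam -> (0 < s_lambda mu lam)%N ->
  sketch_factor * (s_lambda mu lam)%:R <= s%:R ->
  spectral_decomposition (gram K x) U muh ->
  forall i : 'I_n, (s <= i)%N -> muh 0 i <= lam / 4.
Proof.
move=> lam0; set k := s_lambda mu lam => k0 ks sp i si.
have muk : mu k <= lam by exact: s_lambda_le.
have M10 := tail_constant_ge0; have f2 := sketch_factor_ge2.
set c0 := M ^+ 2 * (1 + 2 * M1).
have c00 : 0 <= c0 by rewrite mulr_ge0 ?sqr_ge0//; lra.
have fE : sketch_factor = 4 * c0 + 2 by [].
have k1 : 1 <= k%:R :> R by rewrite ler1n.
have ki : (k <= i)%N.
  apply: leq_trans si; rewrite -(ler_nat R); apply: le_trans ks.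
  by rewrite ler_peMl//; lra.
pose F := (feature_mx phi k x)^T.
have tau_le N : \sum_(k <= l < N) mu l <= (1 + 2 * M1) * k%:R * lam.
  apply: le_trans (tail_partial_sum k N) _.
  apply: ler_pM => //; first by rewrite addr_ge0// mulr_ge0.
  - exact: ltW.
  - by rewrite -natr1; nra.
have trle p (V : 'M[R]_(n, p)) : V^T *m V = 1%:M -> F *m V = 0 ->
    \tr (V^T *m gram K x *m V) <= M ^+ 2 * ((1 + 2 * M1) * k%:R * lam).
  move=> VV FV.
  apply: (gram_trace_le (fun i => ltW (mu_gt0 i)) kernelE phiM tau_le VV) => l lk.
  apply/matrixP => a b; have := congr1 (fun W : 'M[R]_(_, _) => W (Ordinal lk) b) FV.
  rewrite !mxE => h; rewrite -[RHS]h; apply: eq_bigr => m _; by rewrite !mxE.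
have := eigenvalue_le_trace sp trle ki.
have muh0 : 0 <= muh 0 i by case: sp => _ _ _ /(_ i).
have : (s%:R - k%:R + 1) <= (i.+1 - k)%:R :> R.
  rewrite natrB ?(leq_trans ki)// -natr1.
  by have : s%:R <= i%:R :> R by [rewrite ler_nat]; lra.
rewrite fE in ks.
have -> : M ^+ 2 * ((1 + 2 * M1) * k%:R * lam) = c0 * (k%:R * lam) by rewrite /c0; ring.
move: ((i.+1 - k)%:R) => r hr h.
have : (4 * c0 + 1) * k%:R * muh 0 i <= c0 * (k%:R * lam).
  apply: le_trans h; apply: ler_wpM2r => //; lra.
have -> : (4 * c0 + 1) * k%:R * muh 0 i = k%:R * ((4 * c0 + 1) * muh 0 i) by ring.
have -> : c0 * (k%:R * lam) = k%:R * (c0 * lam) by ring.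
rewrite ler_pM2l ?(lt_le_trans _ k1)// => h'.
nra.
Qed.

Lemma exists_sample_sketch lam s n (x : n.-tuple T) :
  0 < lam -> (0 < s_lambda mu lam)%N ->
  sketch_factor * (s_lambda mu lam)%:R <= s%:R ->
  exists S : 'M[rat]_(s, n), good_sketch (gram K x) lam (map_mx ratr S) /\
    (good_design phi s.+1 x -> normal_matrix K x lam (map_mx ratr S) \in unitmx).
Proof.
move=> lam0 k0 ks.
have mu0 i := ltW (mu_gt0 i).
have [U [muh sp]] := psd_spectral (gram_sym kernelE x) (gram_psd mu0 kernelE x).
have [S [gS uS]] := exists_good_sketch lam0 sp (small_eigenvalues lam0 k0 ks sp).
exists S; split=> // gd; apply: uS.
  exact: ltnW (good_design_size gd).
by move=> i si; apply: (good_design_eigenvalue mu_gt0 kernelE gd sp); exact: ltnW.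
Qed.

End SketchExists.

(** * The lower bound on the risk *)

Section RiskLowerBound.
Context {R : realType} {T : Type}.
Variables (D : set T) (H : set (T -> R)) (ip : (T -> R) -> (T -> R) -> R).
Variables (K : T -> T -> R) (mu : nat -> R) (phi : nat -> T -> R).
Hypothesis hH : rkhs D H ip K.
Hypothesis mu_gt0 : forall i, 0 < mu i.
Hypothesis mu_anti : forall i j, (i <= j)%N -> mu j <= mu i.
Hypothesis phiH : forall i, H (phi i).
Hypothesis phi_ip : forall i j, ip (phi i) (phi j) = (i == j)%:R / mu i.
Hypothesis kernelE : forall x x',
  series (fun i => mu i * phi i x * phi i x') @ \oo --> K x x'.

Lemma rkhs_ip0 f : H f -> ip 0 f = 0.
Proof.
move=> Hf; have := rkhs_ip_lin hH 1 (rkhs_0 hH) (rkhs_0 hH) Hf.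
by rewrite scale1r addr0 mul1r => /eqP; rewrite -subr_eq0 opprD addNKr oppr_eq0 => /eqP.
Qed.

Lemma rkhs_ip_sum I (r : seq I) (a : I -> R) (g : I -> T -> R) :
  (forall i, H (g i)) ->
  H (\sum_(i <- r) a i *: g i) /\
  forall f, H f -> ip (\sum_(i <- r) a i *: g i) f = \sum_(i <- r) a i * ip (g i) f.
Proof.
move=> Hg; elim: r => [|i r [IH1 IH2]].
  by split=> [|f Hf]; rewrite !big_nil; [exact: rkhs_0 hH|exact: rkhs_ip0].
split=> [|f Hf]; rewrite !big_cons; first exact: (rkhs_lin hH).
by rewrite (rkhs_ip_lin hH)// IH2.
Qed.

Lemma eigen_comb_ip q (a : 'cV[R]_q) (f := \sum_(i < q) a i 0 *: phi i) :
  H f /\ ip f f = \sum_i a i 0 ^+ 2 / mu i.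
Proof.
have [Hf ipf] := rkhs_ip_sum (index_enum _) (fun i : 'I_q => a i 0) (fun i => phiH i).
split=> //; rewrite /f ipf//; apply: eq_bigr => i _.
rewrite (rkhs_ipC hH)// ipf// (bigD1 i)//= big1 => [|j ji].
  by rewrite phi_ip eqxx mul1r addr0 mulrA -expr2.
by rewrite phi_ip (inj_eq val_inj) (negPf ji) mul0r mulr0.
Qed.

(** The [s] equations [S *m gram K x *m F *m a = 0] in [s + 1] unknowns have a
    nonzero solution; the combination of eigenfunctions that it defines is
    orthogonal, on the sample, to every fitted vector, so that the fit can only
    add to the error. *)
Lemma worst_risk_ge C s n (x : n.-tuple T) lam (S : 'M[R]_(s, n)) e :
  0 < C -> good_design phi s.+1 x ->
  ((C ^+ 2 / 2 * mu s)%:E <= worst_risk K x (hball H ip C) lam S e)%E.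
Proof.
move=> C0 gd; set F := feature_mx phi s.+1 x.
have [a a0 SFa] := exists_kernel_vector (S *m gram K x *m F) (ltnSn s).
pose r (a : 'cV[R]_s.+1) := \sum_(i < s.+1) a i 0 ^+ 2 / mu i : R.
have dr (b : 'cV[R]_s.+1) : mu s * r b <= dotc b b.
  rewrite dotcc mulr_sumr; apply: ler_sum => i _; rewrite mulrCA ler_piMr ?sqr_ge0//.
  by rewrite ler_pdivrMr// mul1r mu_anti// -ltnS.
have r0 : 0 < r a.
  have r1 i : 0 <= a i 0 ^+ 2 / mu i by rewrite divr_ge0 ?sqr_ge0// ltW.
  rewrite lt_def sumr_ge0// andbT psumr_eq0//; apply: contra a0 => /allP h.
  apply/eqP/colP => i; rewrite mxE; have := h i (mem_index_enum _).
  by rewrite /= mulf_eq0 invr_eq0 (gt_eqF (mu_gt0 i)) orbF sqrf_eq0 => /eqP.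
pose c := C / Num.sqrt (r a); pose b := c *: a.
have rb : r b = C ^+ 2.
  rewrite /r /b; under eq_bigr do rewrite mxE exprMn -mulrA.
  by rewrite -mulr_sumr -/(r a) /c exprMn exprVn sqr_sqrtr ?(ltW r0)// divfK// gt_eqF.
have SFb : S *m gram K x *m F *m b = 0 by rewrite -scalemxAr SFa scaler0.
pose f := \sum_(i < s.+1) b i 0 *: phi i.
have [Hf ipf] := eigen_comb_ip b.
have n0 : (0 < n)%N by rewrite (leq_trans _ (good_design_size gd)).
have fE l : f (tnth x l) = (F *m b) l 0.
  rewrite /f fct_sumE mxE; apply: eq_bigr => i _.
  by rewrite mulrC [F l i]mxE.
pose beta := beta_hat K x lam S (responses x f e).
pose g := n%:R *: (gram K x *m (S^T *m beta)).
have gE l : f_hat K x lam S (responses x f e) (tnth x l) = g l 0.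
  rewrite /f_hat /g -/beta [RHS]mxE [in RHS]mxE mulr_sumr; apply: eq_bigr => i _.
  rewrite [gram _ _ _ _]mxE; move: ((S^T *m beta) i 0) => z.
  by rewrite mulrC !mulrA divff ?mul1r// pnatr_eq0 -lt0n.
have gFb : dotc g (F *m b) = 0.
  rewrite dotcZl dotc_mull (gram_sym kernelE) dotc_mull trmxK !mulmxA SFb.
  by rewrite dotc0r mulr0.
apply: (@le_trans _ _ (empnorm2 x (f_hat K x lam S (responses x f e) - f))%:E); last first.
  apply: ereal_sup_ubound; exists f => //; split=> //.
  by rewrite /hnorm ipf -/(r b) rb sqrtr_sqr gtr0_norm.
rewrite lee_fin; apply: (@le_trans _ _ (n%:R^-1 * dotc (F *m b) (F *m b))).
  have := good_design_form b gd; rewrite -/F; apply: le_trans.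
  by have := dr b; rewrite rb; move: (mu s) (dotc b b) => m d; lra.
rewrite /empnorm2; apply: ler_wpM2l; first by rewrite invr_ge0.
clearbody g.
rewrite (_ : \sum_l _ = dotc (g - F *m b) (g - F *m b)).
  by rewrite !dotc_lin (dotcC _ g) gFb; have := dotcc_ge0 g; lra.
rewrite dotcc; apply: eq_bigr => l _.
by rewrite [in RHS]mxE [X in _ = (_ + X) ^+ 2]mxE -gE -fE.
Qed.

End RiskLowerBound.

(** * Hoeffding's inequality *)

Section Independence.
Context {R : realType} {d dT : measure_display}.
Context {Omega : measurableType d} {T : measurableType dT}.
Variable P : probability Omega R.

Import HBNNSimple.

(** Monotone approximation by simple functions carries the identity over from
    indicators.  The weight [W] stands for the factors of a product that involve
    the other variables. *)
Lemma integral_weighted (W : Omega -> R) (V : Omega -> T)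
    (c : R) (Q : probability T R) :
  measurable_fun setT W -> (forall w, 0 <= W w) -> measurable_fun setT V -> 0 <= c ->
  (forall B, measurable B ->
    (\int[P]_w (W w * \1_B (V w))%:E = c%:E * Q B)%E) ->
  forall f : T -> R, measurable_fun setT f -> (forall x, 0 <= f x) ->
    (\int[P]_w (W w * f (V w))%:E = c%:E * \int[Q]_x (f x)%:E)%E.
Proof.
move=> mW W0 mV c0 hB f mf f0.
have mWB B : measurable B -> measurable_fun setT (fun w => W w * \1_B (V w)).
  move=> mB; apply: measurable_funM => //.
  have mI : measurable_fun [set: T] (\1_B : T -> R) by exact: measurable_indic.
  exact: (measurableT_comp mI mV).
have mEf := (measurable_EFinP setT f).2 mf.
pose f_ := nnsfun_approx measurableT mEf.
have cf x : (f_ k x)%:E @[k --> \oo] --> (f x)%:E.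
  by apply: (cvg_nnsfun_approx measurableT mEf) => // y _; rewrite lee_fin.
have ndf x m k : (m <= k)%N -> f_ m x <= f_ k x.
  by move=> mk; exact/lefP/nd_nnsfun_approx.
have mfV k : measurable_fun setT (fun w => f_ k (V w)) by exact: measurableT_comp.
have mfE k : measurable_fun setT (fun x => (f_ k x)%:E) by exact/measurable_EFinP.
have -> : (\int[P]_w (W w * f (V w))%:E = limn (fun k => \int[P]_w (W w * f_ k (V w))%:E))%E.
  rewrite -monotone_convergence//.
  - apply: eq_integral => w _; apply/esym/cvg_lim => //.
    under eq_fun do rewrite EFinM.
    by rewrite EFinM; apply: cvgeZl.
  - by move=> k; exact/measurable_EFinP/measurable_funM.
  - by move=> k w _; rewrite lee_fin mulr_ge0.
  - by move=> w _ m k mk; rewrite lee_fin ler_wpM2l// ndf.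
have -> : (\int[Q]_x (f x)%:E = limn (fun k => \int[Q]_x (f_ k x)%:E))%E.
  rewrite -monotone_convergence//.
  - by apply: eq_integral => w _; apply/esym/cvg_lim.
  - by move=> k x _; rewrite lee_fin.
  - by move=> x _ m k mk; rewrite lee_fin ndf.
rewrite -limeMl//; last first.
  apply: ereal_nondecreasing_is_cvgn => m k mk.
  by apply: ge0_le_integral => // x _; rewrite lee_fin ?ndf.
congr (limn _); apply/funext => k.
have mk r : measurable (f_ k @^-1` [set r]) by exact: measurable_sfunP.
transitivity (\sum_(r \in range (f_ k))
    \int[P]_w (r%:E * (W w * \1_(f_ k @^-1` [set r]) (V w))%:E))%E.
  rewrite -ge0_integral_fsum//=.
  - apply: eq_integral => w _.
    rewrite [X in (_ * X)%:E](fimfunE (f_ k)) mulr_fsumr -fsumEFin//=.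
    by apply: eq_fsbigr => r _; rewrite -EFinM mulrCA.
  - by move=> r; apply/measurable_EFinP; apply: measurable_funM => //; exact: mWB.
  - move=> r w _; rewrite -EFinM lee_fin mulrCA mulr_ge0//.
    by rewrite -lee_fin EFinM nnfun_muleindic_ge0.
rewrite integralT_nnsfun sintegralE ge0_mule_fsumr//; last first.
  move=> r; rewrite nnsfun_mulemu_ge0//.
apply: eq_fsbigr => r /set_mem[x _ fxr].
have r0 : 0 <= r by rewrite -fxr.
rewrite ge0_integralZl//.
- by rewrite hB// muleCA.
- exact/measurable_EFinP/mWB.
- by move=> w _; rewrite lee_fin mulr_ge0.
Qed.

(** From [expR (- x) >= 1 - x], as [1 / (1 - x) <= 1 + x + 2 * x ^+ 2] here. *)
Lemma expR_le_quadratic (x : R) : `|x| <= 2^-1 -> expR x <= 1 + x + 2 * x ^+ 2.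
Proof.
rewrite ler_norml => /andP[x1 x2].
have h := expR_ge1Dx (- x).
have e0 : 0 < expR (- x) by exact: expR_gt0.
have -> : expR x = (expR (- x))^-1 by rewrite expRN invrK.
rewrite -[leLHS]mul1r ler_pdivrMr//.
apply: (@le_trans _ _ ((1 + x + 2 * x ^+ 2) * (1 - x))); first nra.
by rewrite ler_wpM2l//; nra.
Qed.

Variables (PX : probability T R) (X : nat -> {RV P >-> T}).
Hypothesis iidX : iid PX X.

(** Independence is the case of indicators; they are replaced by the functions
    [f i] one variable at a time. *)
Lemma iid_integral_prod n (f : nat -> T -> R) (m : nat -> R) :
  (forall i, measurable_fun setT (f i)) -> (forall i x, 0 <= f i x) ->
  (forall i, (\int[PX]_x (f i x)%:E = (m i)%:E)%E) ->
  (\int[P]_w (\prod_(i < n) f i (X i w))%:E = (\prod_(i < n) m i)%:E)%E.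
Proof.
move=> mf f0 fm.
have m0 i : 0 <= m i.
  by rewrite -lee_fin -fm; apply: integral_ge0 => x _; rewrite lee_fin.
(* The first [j] factors have been replaced. *)
pose g j (A : nat -> set T) i : T -> R := if (i < j)%N then f i else \1_(A i).
pose c j (A : nat -> set T) i : R := if (i < j)%N then m i else fine (PX (A i)).
suff H j A : (forall i, measurable (A i)) ->
    (\int[P]_w (\prod_(i < n) g j A i (X i w))%:E = (\prod_(i < n) c j A i)%:E)%E.
  have := H n (fun=> setT) (fun=> measurableT).
  rewrite [X in _ = X%:E -> _](_ : _ = \prod_(i < n) m i); last first.
    by apply: eq_bigr => i _; rewrite /c ltn_ord.
  move=> <-; apply: eq_integral => w _; congr (_%:E); apply: eq_bigr => i _.
  by rewrite /g ltn_ord.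
have mg k B i : (forall i, measurable (B i)) -> measurable_fun setT (g k B i).
  by move=> mB; rewrite /g; case: ifP => _ //; exact: measurable_indic.
have g0 k B i x : 0 <= g k B i x by rewrite /g; case: ifP.
have mX i : measurable_fun setT (X i) by [].
elim: j A => [|j IHj] A mA.
  have -> : (fun w => (\prod_(i < n) g 0 A i (X i w))%:E) =
      (fun w => (\1_(\bigcap_(i < n) (X i @^-1` A i)) w)%:E).
    apply/funext => w; congr (_%:E); rewrite indicE.
    have [wA|wA] := boolP (_ \in _).
      rewrite big1// => i _; rewrite /g /= indicE mem_set//.
      by move: wA => /set_mem /(_ i (ltn_ord i)).
    apply/eqP; move: wA; apply: contraR => p0; apply/mem_set => i /= ni.
    move: p0; rewrite (bigD1 (Ordinal ni))//= mulf_eq0 negb_or /g /= => /andP[+ _].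
    by rewrite indicE; case: (boolP (_ \in _)) => [/set_mem//|]; rewrite eqxx.
  rewrite integral_indic// ?setIT; last first.
    apply: bigcap_measurableType => i _; rewrite -[X in measurable X]setTI; exact: mX.
  transitivity (\prod_(i < n) P (X i @^-1` A i))%E; first exact: (iidX.2 n A mA).
  rewrite -prodEFin; apply: eq_bigr => i _.
  by rewrite /c /= fineK ?fin_num_measure// -(iidX.1 i).
have [nj|jn] := leqP n j.
  rewrite [RHS](_ : _ = (\prod_(i < n) c j A i)%:E); last first.
    congr (_%:E); apply: eq_bigr => i _.
    by rewrite /c ltnS (leq_trans (ltn_ord i) nj) (ltnW (leq_trans (ltn_ord i) nj)).
  rewrite -IHj//; apply: eq_integral => w _; congr (_%:E); apply: eq_bigr => i _.
  by rewrite /g ltnS (leq_trans (ltn_ord i) nj) (ltnW (leq_trans (ltn_ord i) nj)).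
pose o := Ordinal jn.
pose W w := \prod_(i < n | i != o) g j A i (X i w).
pose C := \prod_(i < n | i != o) c j A i.
have W0 w : 0 <= W w by apply: prodr_ge0.
have C0 : 0 <= C by apply: prodr_ge0 => i _; rewrite /c; case: ifP => // _; exact: fine_ge0.
have mW : measurable_fun setT W.
  rewrite (_ : W = fun w => \prod_(i <- index_enum 'I_n)
      (if i != o then g j A i (X i w) else 1)); last first.
    by apply/funext => w; rewrite /W big_mkcond.
  apply: (@measurable_prod _ _ _ _ _ _ (fun (i : 'I_n) w =>
      if i != o then g j A i (X i w) else 1)) => i _.
  case: (i != o); last exact: measurable_cst.
  exact: (measurableT_comp (mg _ _ _ mA) (mX i)).
have key B : measurable B -> (\int[P]_w (W w * \1_B (X j w))%:E = C%:E * PX B)%E.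
  move=> mB; pose A' i := if i == j then B else A i.
  have mA' i : measurable (A' i) by rewrite /A'; case: ifP.
  have := IHj A' mA'.
  rewrite [X in _ = X%:E -> _](bigD1 o)//=.
  have -> : c j A' j = fine (PX B) by rewrite /c ltnn /A' eqxx.
  have -> : \prod_(i < n | i != o) c j A' i = C.
    by apply: eq_bigr => i io; rewrite /c /A' -[i == j :> nat]/(i == o) (negPf io).
  rewrite EFinM fineK ?fin_num_measure// muleC => <-.
  apply: eq_integral => w _; congr (_%:E); rewrite (bigD1 o)//= mulrC; congr (_ * _).
    by rewrite /g ltnn /A' eqxx.
  by apply: eq_bigr => i io; rewrite /g /A' -[i == j :> nat]/(i == o) (negPf io).
have := integral_weighted mW W0 (mX j) C0 key (mf j) (f0 j).
rewrite fm -EFinM => h.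
rewrite (bigD1 o)//= {1}/c ltnSn mulrC.
have -> : \prod_(i < n | i != o) c j.+1 A i = C.
  apply: eq_bigr => i io; rewrite /c ltnS leq_eqVlt -[i == j :> nat]/(i == o).
  by rewrite (negPf io).
rewrite -h; apply: eq_integral => w _; congr (_%:E).
rewrite (bigD1 o)//= {1}/g ltnSn mulrC; congr (_ * _).
apply: eq_bigr => i io; rewrite /g ltnS leq_eqVlt -[i == j :> nat]/(i == o).
by rewrite (negPf io).
Qed.


(** The mean of [Y] vanishes, so only the quadratic term of the exponential
    contributes; [u / (4 * B ^+ 2)] minimizes the exponent
    [2 * t ^+ 2 * B ^+ 2 - t * u]. *)
Lemma integral_exp_le (Y : T -> R) (B u : R) :
  measurable_fun setT Y -> (forall x, `|Y x| <= B) -> 0 < B ->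
  (\int[PX]_x (Y x)%:E = 0)%E -> 0 < u -> u <= 2 * B ->
  exists m, (\int[PX]_x (expR (u / (4 * B ^+ 2) * (Y x - u)))%:E = m%:E)%E /\
    m <= expR (- (u ^+ 2 / (8 * B ^+ 2))).
Proof.
move=> mY YB B0 Y0 u0 uB; set t := u / (4 * B ^+ 2).
have B20 : 0 < 4 * B ^+ 2 by rewrite mulr_gt0 ?exprn_gt0.
have t0 : 0 < t by rewrite divr_gt0.
have tB : t * B <= 2^-1.
  rewrite /t mulrAC ler_pdivrMr//; nra.
pose q x := (1 + t * Y x + 2 * (t * B) ^+ 2).
have expq x : expR (t * (Y x - u)) <= expR (- (t * u)) * q x.
  rewrite mulrBr addrC expRD; apply: ler_wpM2l; first exact: expR_ge0.
  have tY : `|t * Y x| <= t * B by rewrite normrM gtr0_norm// ler_pM2l.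
  apply: le_trans (expR_le_quadratic (le_trans tY tB)) _.
  rewrite /q lerD2l ler_wpM2l// -(real_normK (num_real (t * Y x))).
  by rewrite lerXn2r ?nnegrE// (le_trans _ tY).
have iY : PX.-integrable setT (EFin \o Y).
  apply: (@le_integrable _ _ _ _ _ _ _ (fun=> B%:E)) => //.
  - exact/measurable_EFinP.
  - by move=> x _; rewrite /= lee_fin (ger0_norm (ltW B0)).
  - exact: finite_measure_integrable_cst.
have mexp : measurable_fun setT (fun x => (expR (t * (Y x - u)))%:E).
  apply/measurable_EFinP; apply: measurableT_comp => //.
  by apply: measurable_funM => //; apply: measurable_funB.
have le : (\int[PX]_x (expR (t * (Y x - u)))%:E <=
    (expR (- (t * u)) * (1 + 2 * (t * B) ^+ 2))%:E)%E.
  have mq : measurable_fun setT (fun x => (expR (- (t * u)) * q x)%:E).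
    apply/measurable_EFinP; apply: measurable_funM => //.
    by apply: measurable_funD => //; apply: measurable_funD => //; apply: measurable_funM.
  apply: (@le_trans _ _ (\int[PX]_x (expR (- (t * u)) * q x)%:E)%E).
    apply: ge0_le_integral => //.
    by move=> x _; rewrite lee_fin.
  have iq : PX.-integrable setT (fun x => (t * Y x)%:E).
    by under eq_fun do rewrite EFinM; exact: integrableZl.
  have ic c : PX.-integrable setT (fun=> c%:E) by exact: finite_measure_integrable_cst.
  under eq_integral do rewrite EFinM.
  rewrite integralZl//; last first.
    under eq_fun do rewrite /q EFinD EFinD.
    by apply: integrableD => //; apply: integrableD.
  rewrite EFinM lee_wpmul2l ?lee_fin ?expR_ge0//.
  under eq_integral do rewrite /q EFinD EFinD.
  rewrite integralD//; last by apply: integrableD.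
  have ic1 c : (\int[PX]_x c%:E = c%:E)%E.
    rewrite integral_cst//=.
    by rewrite [X in (_ * X)%E](probability_setT PX) mule1.
  have -> : (\int[PX]_x (1 + (t * Y x)%:E) = 1 + \int[PX]_x (t * Y x)%:E)%E.
    by rewrite (integralD measurableT (ic 1) iq) ic1.
  rewrite ic1.
  under eq_integral do rewrite EFinM.
  by rewrite integralZl// Y0 mule0 adde0.
have ge : (0 <= \int[PX]_x (expR (t * (Y x - u)))%:E)%E.
  by apply: integral_ge0 => x _; rewrite lee_fin expR_ge0.
exists (fine (\int[PX]_x (expR (t * (Y x - u)))%:E)%E); split.
  by rewrite fineK// ge0_fin_numE// (le_lt_trans le)// ltry.
rewrite -lee_fin fineK; last by rewrite ge0_fin_numE// (le_lt_trans le)// ltry.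
apply: (le_trans le); rewrite lee_fin.
apply: (@le_trans _ _ (expR (- (t * u)) * expR (2 * (t * B) ^+ 2))).
  by rewrite ler_wpM2l ?expR_ge0// expR_ge1Dx.
rewrite -expRD ler_expR le_eqVlt; apply/orP; left; apply/eqP.
by rewrite /t; field; rewrite gt_eqF.
Qed.

(** Chernoff's argument: the indicator of the event is at most the product of the
    exponentials of [t * (Y (X i w) - u)]. *)
Lemma hoeffding n (Y : T -> R) (B u : R) :
  measurable_fun setT Y -> (forall x, `|Y x| <= B) -> 0 < B ->
  (\int[PX]_x (Y x)%:E = 0)%E -> 0 < u -> u <= 2 * B ->
  (P [set w | (n%:R * u <= \sum_(i < n) Y (X i w))%R] <=
    (expR (- (n%:R * (u ^+ 2 / (8 * B ^+ 2)))))%:E)%E.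
Proof.
move=> mY YB B0 Y0 u0 uB.
have [m [mE mle]] := integral_exp_le mY YB B0 Y0 u0 uB.
set t := u / (4 * B ^+ 2) in mE.
have t0 : 0 < t by rewrite divr_gt0// mulr_gt0// exprn_gt0.
have m0 : 0 <= m.
  by rewrite -lee_fin -mE; apply: integral_ge0 => x _; rewrite lee_fin expR_ge0.
have mf : measurable_fun setT (fun x => expR (t * (Y x - u))).
  apply: measurableT_comp => //.
  by apply: measurable_funM => //; apply: measurable_funB.
have := iid_integral_prod n (fun=> mf) (fun _ x => expR_ge0 _) (fun=> mE).
rewrite prodr_const card_ord => intE.
apply: (@le_trans _ _ (m ^+ n)%:E); last first.
  rewrite lee_fin -mulrN mulrC expRM_natr.
  by rewrite lerXn2r ?nnegrE ?expR_ge0.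
set A := (X in P X).
have mX i : measurable_fun setT (fun w => Y (X i w)) by exact: measurableT_comp.
have mS : measurable_fun setT (fun w => \sum_(i < n) Y (X i w)).
  exact: measurable_sum.
have mA : measurable A.
  rewrite -[A]setTI; apply: measurable_fun_le => //.
rewrite -intE -[A]setIT -integral_indic//.
apply: ge0_le_integral => //.
- apply/measurable_EFinP; exact: measurable_indic.
- apply/measurable_EFinP; apply: measurable_prod => i _.
  exact: (measurableT_comp mf).
move=> w _; rewrite lee_fin -expR_sum indicE.
have [/set_mem wA|_] := boolP (w \in A); last exact: expR_ge0.
rewrite -expR0 ler_expR -mulr_sumr mulr_ge0 ?(ltW t0)// sumrB subr_ge0.
by rewrite sumr_const card_ord -mulr_natl.
Qed.

End Independence.

(** * Measurable choice of the sketch *)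

Section Measurability.
Context {R : realType} {d : measure_display} {V : measurableType d}.

Lemma countable_bigcapT_measurable (I : countType) (F : I -> set V) :
  (forall i, measurable (F i)) -> measurable (\bigcap_i F i).
Proof.
move=> mF; rewrite -[X in measurable X]setCK setC_bigcap; apply: measurableC.
by apply: countable_bigcupT_measurable => // i; exact: measurableC.
Qed.

Lemma measurable_forall (I : countType) (Q : I -> V -> Prop) :
  (forall i, measurable [set v | Q i v]) -> measurable [set v | forall i, Q i v].
Proof.
move=> mQ; rewrite (_ : [set v | _] = \bigcap_i [set v | Q i v]).
  exact: countable_bigcapT_measurable.
by apply/seteqP; split=> [v h i _|v h i]; exact: h.
Qed.

(** The first element of an enumeration that satisfies the condition: the set
    where it is the [k]-th one involves only finitely many conditions. *)
Lemma measurable_selection (I : countType) (Q : I -> V -> Prop) :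
  (forall i, measurable [set v | Q i v]) -> (forall v, exists i, Q i v) ->
  exists g : V -> I, (forall C : set I, measurable (g @^-1` C)) /\ forall v, Q (g v) v.
Proof.
move=> mQ exQ.
pose E k := [set v | exists i, unpickle k = Some i /\ Q i v].
have mE k : measurable (E k).
  rewrite /E; case: (unpickle k) => [i|].
    rewrite (_ : [set v | _] = [set v | Q i v])//.
    by apply/seteqP; split=> [v [_ [[<-]]]//|v Qv]; exists i.
  by rewrite (_ : [set v | _] = set0)//; apply/seteqP; split=> [v [i []]|].
have exE v : exists k, `[< E k v >].
  by have [i Qi] := exQ v; exists (pickle i); apply/asboolP; exists i; rewrite pickleK.
pose m v := ex_minn (exE v).
have mP v : E (m v) v /\ forall k, E k v -> (m v <= k)%N.
  rewrite /m; case: ex_minnP => k /asboolP Ek kmin; split=> // j Ej.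
  by apply: kmin; apply/asboolP.
have /choice[g gP] : forall v, exists i, unpickle (m v) = Some i /\ Q i v.
  by move=> v; exact: (mP v).1.
exists g; split=> [C|v]; last exact: (gP v).2.
pose F k := E k `\` \bigcup_(j < k) E j.
have mF k : measurable (F k).
  by apply: measurableD => //; exact: bigcup_measurable.
rewrite (_ : _ @^-1` _ = \bigcup_(k in [set k | exists i, unpickle k = Some i /\ C i]) F k).
  exact: bigcup_measurable.
apply/seteqP; split=> [v Cv|v [k /= [i [ki Ci]] [Ek Nk]]] /=.
  exists (m v) => /=; first by exists (g v); split=> //; exact: (gP v).1.
  split; first exact: (mP v).1.
  by move=> [j /= jm Ej]; have := (mP v).2 _ Ej; rewrite leqNgt jm.
suff mk : m v = k by have := (gP v).1; rewrite mk ki => -[<-].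
apply/eqP; rewrite eqn_leq (mP v).2// leqNgt; apply/negP => mlt.
by apply: Nk; exists (m v) => //; exact: (mP v).1.
Qed.

Definition mx_measurable p q (A : V -> 'M[R]_(p, q)) :=
  forall i j, measurable_fun setT (fun v => A v i j).

Lemma mx_measurable_cst p q (A : 'M[R]_(p, q)) : mx_measurable (fun=> A).
Proof. by move=> i j; exact: measurable_cst. Qed.

Lemma mx_measurableD p q (A B : V -> 'M[R]_(p, q)) :
  mx_measurable A -> mx_measurable B -> mx_measurable (fun v => A v + B v).
Proof.
by move=> mA mB i j; under eq_fun do rewrite mxE; exact: measurable_funD.
Qed.

Lemma mx_measurableZ p q (a : R) (A : V -> 'M[R]_(p, q)) :
  mx_measurable A -> mx_measurable (fun v => a *: A v).
Proof.
by move=> mA i j; under eq_fun do rewrite mxE; exact: measurable_funM.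
Qed.

Lemma mx_measurableM p q r (A : V -> 'M[R]_(p, q)) (B : V -> 'M[R]_(q, r)) :
  mx_measurable A -> mx_measurable B -> mx_measurable (fun v => A v *m B v).
Proof.
move=> mA mB i j; under eq_fun do rewrite mxE.
by apply: measurable_sum => k; exact: measurable_funM.
Qed.

Lemma measurable_dotc p (A B : V -> 'cV[R]_p) :
  mx_measurable A -> mx_measurable B -> measurable_fun setT (fun v => dotc (A v) (B v)).
Proof. by move=> mA mB; apply: measurable_sum => k; exact: measurable_funM. Qed.

Lemma measurable_det p (A : V -> 'M[R]_p) :
  mx_measurable A -> measurable_fun setT (fun v => \det (A v)).
Proof.
move=> mA; apply: measurable_sum => k; apply: measurable_funM => //.
by apply: measurable_prod => i _; exact: mA.
Qed.

Lemma measurable_unitmx p (A : V -> 'M[R]_p) :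
  mx_measurable A -> measurable [set v | A v \in unitmx].
Proof.
move=> mA; rewrite (_ : [set v | _] = ~` ((fun v => \det (A v)) @^-1` [set 0])).
  apply: measurableC; rewrite -[X in measurable X]setTI.
  exact: (measurable_det mA).
by apply/seteqP; split=> v /=; rewrite unitmxE unitfE => /eqP.
Qed.

Lemma measurable_ge0 (f : V -> R) :
  measurable_fun setT f -> measurable [set v | 0 <= f v].
Proof. by move=> mf; rewrite -[X in measurable X]setTI; exact: measurable_fun_le. Qed.

End Measurability.

Section SketchSelection.
Context {R : realType} {dT : measure_display} {T : measurableType dT}.
Variables (K : T -> T -> R) (mu : nat -> R) (phi : nat -> T -> R).
Hypothesis kernelE : forall x x',
  series (fun i => mu i * phi i x * phi i x') @ \oo --> K x x'.
Hypothesis mphi : forall i, measurable_fun setT (phi i).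

Let mphi_tnth n i (l : 'I_n) :
  measurable_fun [set: n.-tuple T] (fun v : n.-tuple T => phi i (tnth v l)).
Proof. exact: (measurableT_comp (mphi i) (measurable_tnth l)). Qed.

Lemma measurable_gram n : mx_measurable (fun v : n.-tuple T => gram K v).
Proof.
move=> i j; under eq_fun do rewrite mxE; apply: measurable_funM => //.
apply: (@measurable_fun_cvg _ _ _ setT (fun N (v : n.-tuple T) =>
    series (fun l => mu l * phi l (tnth v i) * phi l (tnth v j)) N)).
  move=> N; rewrite /series/=; apply: measurable_sum => l.
  apply: measurable_funM; last exact: mphi_tnth.
  by apply: measurable_funM => //; exact: mphi_tnth.
by move=> v _; exact: kernelE.
Qed.

Lemma measurable_good_design q n :
  measurable [set v : n.-tuple T | good_design phi q v].
Proof.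
apply: measurable_forall => i; apply: measurable_forall => j.
rewrite -[X in measurable X]setTI; apply: measurable_fun_le => //.
apply: measurableT_comp => //; apply: measurable_funB => //.
apply: measurable_funM => //; apply: measurable_sum => l.
by apply: measurable_funM; exact: mphi_tnth.
Qed.

(** Density makes the quantifier over test vectors countable. *)
Lemma good_sketch_rational n s (A : 'M[R]_n) lam (S : 'M[R]_(s, n)) :
  good_sketch A lam S <-> (forall v, dotc (S *m v) (S *m v) <= 3 / 2 * dotc v v) /\
  (forall w : 'cV[rat]_n, let w' := map_mx ratr w in
     0 <= dotc (S *m (A *m w')) (S *m (A *m w'))
      - 3 / 4 * dotc (A *m w') (A *m w') + lam / 4 * dotc w' (A *m w')).
Proof.
split=> -[Sle Sge]; split=> // w.
have [Q Qw] := rational_approx w.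
pose w_ k : 'cV[R]_n := map_mx ratr (Q k).
have cw : mx_cvg w_ w by move=> i j; under eq_fun do rewrite mxE; exact: Qw.
have cA : mx_cvg (fun k => A *m w_ k) (A *m w).
  by apply: mx_cvgM => //; exact: mx_cvg_cst.
have cS : mx_cvg (fun k => S *m (A *m w_ k)) (S *m (A *m w)).
  by apply: mx_cvgM => //; exact: mx_cvg_cst.
have c : dotc (S *m (A *m w_ k)) (S *m (A *m w_ k))
      - 3 / 4 * dotc (A *m w_ k) (A *m w_ k) + lam / 4 * dotc (w_ k) (A *m w_ k)
    @[k --> \oo] --> dotc (S *m (A *m w)) (S *m (A *m w))
      - 3 / 4 * dotc (A *m w) (A *m w) + lam / 4 * dotc w (A *m w).
  apply: cvgD; last by apply: cvgM; [exact: cvg_cst|exact: mx_cvg_dotc].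
  apply: cvgB; first exact: mx_cvg_dotc.
  by apply: cvgM; [exact: cvg_cst|exact: mx_cvg_dotc].
by apply: (cvgr_to_ge c); apply: nearW => k; exact: Sge.
Qed.

Lemma measurable_good_sketch n s lam (S : 'M[R]_(s, n)) :
  measurable [set v : n.-tuple T | good_sketch (gram K v) lam S].
Proof.
rewrite (eq_set (fun v => propext (good_sketch_rational _ _ _))).
have [Sle|Sle] := pselect (forall v, dotc (S *m v) (S *m v) <= 3 / 2 * dotc v v); last first.
  by rewrite (_ : [set v | _] = set0)//; apply/seteqP; split=> v // -[].
rewrite (_ : [set v | _] = [set v : n.-tuple T | forall w : 'cV[rat]_n,
    let w' := map_mx ratr w in
    0 <= dotc (S *m (gram K v *m w')) (S *m (gram K v *m w'))
      - 3 / 4 * dotc (gram K v *m w') (gram K v *m w')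
      + lam / 4 * dotc w' (gram K v *m w')]); last first.
  by apply/seteqP; split=> v // -[].
apply: measurable_forall => w; apply: measurable_ge0.
have mg := @measurable_gram n.
have mA : mx_measurable (fun v : n.-tuple T => gram K v *m map_mx ratr w).
  by apply: mx_measurableM => //; exact: mx_measurable_cst.
have mSA : mx_measurable (fun v : n.-tuple T => S *m (gram K v *m map_mx ratr w)).
  by apply: mx_measurableM => //; exact: mx_measurable_cst.
apply: measurable_funD.
  apply: measurable_funB; first exact: measurable_dotc.
  by apply: measurable_funM => //; exact: measurable_dotc.
apply: measurable_funM => //; apply: measurable_dotc => //; exact: mx_measurable_cst.
Qed.

Lemma measurable_normal_matrix_unit n s lam (S : 'M[R]_(s, n)) :
  measurable [set v : n.-tuple T | normal_matrix K v lam S \in unitmx].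
Proof.
have mg := @measurable_gram n.
have cst p q (B : 'M[R]_(p, q)) : mx_measurable (fun _ : n.-tuple T => B).
  exact: mx_measurable_cst.
apply: measurable_unitmx; apply: mx_measurableD; last apply: mx_measurableZ.
  apply: mx_measurableM => //; apply: mx_measurableM => //; exact: mx_measurableM.
by apply: mx_measurableM => //; exact: mx_measurableM.
Qed.

Hypothesis mu_gt0 : forall i, 0 < mu i.
Variables M M1 : R.
Hypothesis phiM : forall i x, `|phi i x| <= M.
Hypothesis tailM : forall k : nat,
    (\sum_(k.+1 <= i <oo) (mu i)%:E <= (M1 * (k.+1%:R * mu k))%:E)%E.

Lemma exists_measurable_sketch n s lam :
  0 < lam -> (0 < s_lambda mu lam)%N ->
  sketch_factor M M1 * (s_lambda mu lam)%:R <= s%:R ->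
  exists g : n.-tuple T -> 'M[rat]_(s, n),
    (forall C, measurable (g @^-1` C)) /\
    forall v, let S : 'M[R]_(s, n) := map_mx ratr (g v) in
      good_sketch (gram K v) lam S /\
      (good_design phi s.+1 v -> normal_matrix K v lam S \in unitmx).
Proof.
move=> lam0 k0 ks.
apply: (measurable_selection (Q := fun (S : 'M[rat]_(s, n)) (v : n.-tuple T) =>
    good_sketch (gram K v) lam (map_mx ratr S : 'M[R]_(s, n)) /\
    (good_design phi s.+1 v ->
      normal_matrix K v lam (map_mx ratr S : 'M[R]_(s, n)) \in unitmx))); last first.
  move=> v; exact: (exists_sample_sketch mu_gt0 kernelE phiM tailM).
move=> S; apply: measurableI; first exact: measurable_good_sketch.
rewrite [X in measurable X](_ : _ = ~` [set v : n.-tuple T | good_design phi s.+1 v] `|`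
    [set v : n.-tuple T | normal_matrix K v lam (map_mx ratr S : 'M[R]_(s, n)) \in unitmx]).
  apply: measurableU; last exact: measurable_normal_matrix_unit.
  by apply: measurableC; exact: measurable_good_design.
apply/seteqP; split=> v /=.
  by have [gd h|] := pselect (good_design phi s.+1 v); [right; exact: h|left].
by case.
Qed.

End SketchSelection.

(** * Concentration of the empirical Gram matrix *)

Section Concentration.
Context {R : realType} {d dT : measure_display}.
Context {Omega : measurableType d} {T : measurableType dT}.
Variables (P : probability Omega R) (PX : probability T R) (X : nat -> {RV P >-> T}).
Hypothesis iidX : iid PX X.
Variables (phi : nat -> T -> R) (M : R).
Hypothesis mphi : forall i, measurable_fun setT (phi i).
Hypothesis phiM : forall i x, `|phi i x| <= M.
Hypothesis phi_orth : forall i j, L2ip PX (phi i) (phi j) = (i == j)%:R.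

Lemma measurable_sample n : measurable_fun setT (sample X n).
Proof.
apply/measurable_fun_tnthP => i.
rewrite (_ : _ \o _ = X i)//; apply/funext => w /=; by rewrite tnth_mktuple.
Qed.

Lemma union_bound (I : Type) (r : seq I) (A : I -> set Omega) (b : R) :
  (forall i, measurable (A i)) -> (forall i, (P (A i) <= b%:E)%E) ->
  (P (\big[setU/set0]_(i <- r) A i) <= ((size r)%:R * b)%:E)%E.
Proof.
move=> mA Ab; elim: r => [|i r IH].
  by rewrite big_nil measure0 mul0r.
rewrite big_cons; apply: le_trans.
  by apply: measureU2 => //; exact: bigsetU_measurable.
by rewrite /= -natr1 mulrDl mul1r addrC EFinD leeD.
Qed.

(** A union bound over the [q ^ 2] entries and the two signs of a deviation by
    [1 / (2 q)]. *)
Lemma good_design_prob q n : (0 < q)%N ->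
  (P (~` (sample X n @^-1` [set v | good_design phi q v])) <=
    (2 * q%:R ^+ 2 * expR (- (n%:R / (32 * (M ^+ 2 + 1) ^+ 2 * q%:R ^+ 2))))%:E)%E.
Proof.
move=> q0; pose u : R := 2^-1 / q%:R; pose B := M ^+ 2 + 1.
have q1 : 1 <= q%:R :> R by rewrite ler1n.
have B1 : 1 <= B by rewrite /B lerDr sqr_ge0.
have u0 : 0 < u by rewrite divr_gt0// (lt_le_trans _ q1).
have uB : u <= 2 * B.
  rewrite /u ler_pdivrMr ?(lt_le_trans _ q1)//; nra.
pose Y (b : bool) (i j : nat) x := (-1) ^+ b * (phi i x * phi j x - (i == j)%:R).
pose I : finType := (bool * ('I_q * 'I_q))%type.
pose A (p : I) := [set w | n%:R * u <= \sum_(l < n) Y p.1 p.2.1 p.2.2 (X l w)].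
have mY b i j : measurable_fun setT (Y b i j).
  apply: measurable_funM => //; apply: measurable_funB => //.
  exact: measurable_funM.
have mA p : measurable (A p).
  rewrite -[A p]setTI; apply: measurable_fun_le => //; apply: measurable_sum => l.
  exact: measurableT_comp.
have YB b i j x : `|Y b i j x| <= B.
  rewrite normrM normrX normrN1 expr1n mul1r; apply: le_trans (ler_normB _ _) _.
  apply: lerD; last by rewrite ger0_norm// lern1 leq_b1.
  by rewrite normrM expr2; apply: ler_pM.
have Y0 b i j : (\int[PX]_x (Y b i j x)%:E = 0)%E.
  have ic c : PX.-integrable setT (fun=> c%:E) by exact: finite_measure_integrable_cst.
  have ipp : PX.-integrable setT (fun x => (phi i x * phi j x)%:E).
    apply: (@le_integrable _ _ _ _ _ _ _ (fun=> (M ^+ 2)%:E)) => //.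
      by apply/measurable_EFinP; exact: measurable_funM.
    move=> x _; rewrite /= lee_fin normrM (ger0_norm (sqr_ge0 _)) expr2.
    exact: ler_pM.
  under eq_integral do rewrite EFinM.
  rewrite integralZl//; last first.
    by under eq_fun do rewrite EFinB; apply: integrableB.
  under eq_integral do rewrite EFinB.
  rewrite (integralB measurableT ipp (ic _)) integral_cst//=.
  rewrite [X in (_ - _ * X)%E](probability_setT PX) mule1.
  have := phi_orth i j; rewrite /L2ip /Rintegral => <-.
  rewrite fineK ?subee ?mule0//; last exact: integrable_fin_num.
  exact: integrable_fin_num.
have Ab p : (P (A p) <= (expR (- (n%:R / (32 * B ^+ 2 * q%:R ^+ 2))))%:E)%E.
  have := hoeffding iidX n (mY p.1 p.2.1 p.2.2) (YB _ _ _) (lt_le_trans ltr01 B1) (Y0 _ _ _) u0 uB.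
  rewrite (_ : u ^+ 2 / (8 * B ^+ 2) = (32 * B ^+ 2 * q%:R ^+ 2)^-1)//.
  rewrite /u; field.
  by rewrite !gt_eqF// (lt_le_trans ltr01).
apply: (@le_trans _ _ (P (\big[setU/set0]_(p <- enum I) A p))).
  apply: le_measure; rewrite ?inE.
  - apply: measurableC; rewrite -[X in measurable X]setTI.
    exact: (measurable_sample measurableT (measurable_good_design mphi q (n := n))).
  - exact: bigsetU_measurable.
  move=> w /= /existsNP[i /existsNP[j]].
  move=> /negP; rewrite -ltNge -/u => bad; rewrite -bigcup_seq.
  pose S := \sum_(l < n) (phi i (X l w) * phi j (X l w) - (i == j)%:R).
  have SY b : \sum_(l < n) Y b i j (X l w) = (-1) ^+ b * S by rewrite mulr_sumr.
  have nS : n%:R * u <= `|S|.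
    have [n0|n0] := posnP n; first by rewrite n0 mul0r.
    rewrite -ler_pdivlMl ?ltr0n//; apply: ltW; apply: lt_le_trans bad _.
    rewrite -[X in X * `|S|]gtr0_norm ?invr_gt0 ?ltr0n// -normrM.
    rewrite /S sumrB sumr_const card_ord -(mulr_natl ((i == j)%:R : R) n) mulrBr mulKf ?pnatr_eq0 -?lt0n//.
    by under eq_bigr do rewrite !tnth_mktuple.
  exists (S < 0, (i, j)); first by rewrite /= mem_enum.
  rewrite /A /= SY; case: ltP nS => S0; first by rewrite ltr0_norm// expr1 mulN1r.
  by rewrite ger0_norm// expr0 mul1r.
have := union_bound (enum I) mA Ab.
by rewrite -cardE !card_prod card_bool !card_ord !natrM mulrA -/B expr2 !mulrA.
Qed.

End Concentration.

(** * Comparison of the rates *)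

Section Asymptotics.
Context {R : realType}.
Implicit Types k : decay R.

Lemma powR_expE (x a : R) : 0 < x -> x `^ a = expR (a * ln x).
Proof. by move=> x0; rewrite /powR gt_eqF. Qed.

Lemma near_ln (A : R) : \forall n \near \oo, A <= ln (n%:R : R).
Proof.
apply: filterS (nbhs_infty_ger (expR A)) => n /= h.
rewrite -[A]expRK ler_ln// posrE ?expR_gt0//.
exact: lt_le_trans (expR_gt0 _) h.
Qed.

Lemma exp_dominates (al b : R) : 0 < al -> 0 < b ->
  exists L0, forall L, L0 <= L -> b * (L + 1) < expR (al * L).
Proof.
move=> al0 b0; exists (1 + 8 * b / al ^+ 2) => L hL.
have al2 : 0 < al ^+ 2 by rewrite exprn_gt0.
have L1 : 1 <= L by apply: le_trans hL; rewrite lerDl divr_ge0 ?(ltW al2)// mulr_ge0// ltW.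
have Lb : 8 * b < L * al ^+ 2.
  by rewrite -ltr_pdivrMr//; apply: lt_le_trans hL; rewrite ltrDr.
have x0 : 0 < al * L by rewrite mulr_gt0//; lra.
have h : 1 + al * L / 2 <= expR (al * L / 2) by exact: expR_ge1Dx.
have -> : expR (al * L) = expR (al * L / 2) ^+ 2.
  by rewrite -expRM_natr; congr expR; field.
apply: (@lt_le_trans _ _ ((1 + al * L / 2) ^+ 2)); last first.
  by rewrite lerXn2r ?nnegrE ?expR_ge0// addr_ge0// divr_ge0// ltW.
have : 8 * b * L < L * al ^+ 2 * L by rewrite ltr_pM2r//; lra.
have : b * 1 <= b * L by rewrite ler_pM2l.
nra.
Qed.

(** The decays with a summable sequence of eigenvalues. *)
Definition summable_decay k : Prop :=
  match k with PDK m => 1 < 2 * m | EDK gamma p => 0 < gamma /\ 1 <= p end.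

Lemma decay_rate_gt0 k i : 0 < decay_rate k i.+1.
Proof. by case: k => [m|g p] /=; [rewrite powR_gt0|rewrite expR_gt0]. Qed.

Lemma has_decay_gt0 k mu : has_decay k mu -> forall i, 0 < mu i.
Proof.
move=> [c [C [c0 _ h]]] i; have /andP[+ _] := h i.
by apply: lt_le_trans; rewrite mulr_gt0// decay_rate_gt0.
Qed.

(** For [2 * m <= 1] the eigenvalues would dominate a multiple of the harmonic
    series. *)
Lemma has_decay_summable k mu (M1 : R) :
  decay_valid k -> has_decay k mu ->
  (forall k : nat,
    (\sum_(k.+1 <= i <oo) (mu i)%:E <= (M1 * (k.+1%:R * mu k))%:E)%E) ->
  summable_decay k.
Proof.
move=> vk hk tail; have mu0 := has_decay_gt0 hk.
case: k vk hk => [m _|//] [c [C [c0 _ h]]] /=; rewrite ltNge; apply/negP => m1.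
apply: (@dvg_harmonic R); apply: nondecreasing_is_cvgn.
  apply/nondecreasing_seqP => n; rewrite /series/= big_nat_recr//= lerDl.
  by rewrite /harmonic/= invr_ge0.
exists (c^-1 * ((1 + M1 * 1%:R) * mu 0%N)) => _ [N _ <-].
rewrite ler_pdivlMl//; apply: le_trans (tail_partial_sum mu0 tail 0 N).
rewrite /series/= mulr_sumr; apply: ler_sum => i _.
have /andP[hi _] := h i; apply: le_trans hi; rewrite ler_pM2l//=.
rewrite powRN /harmonic/= lef_pV2 ?posrE ?powR_gt0//.
by rewrite ler1_powR// ler1n.
Qed.

Lemma near_s_dagger k (A : R) : summable_decay k ->
  \forall n \near \oo, A <= s_dagger k n.
Proof.
case: k => [m|g p] /=.
  move=> m1; have m0 : 0 < 2 * m + 1 by lra.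
  near=> n.
  have n0 : 0 < n%:R :> R.
    by rewrite ltr0n; near: n; exact: nbhs_infty_gt.
  rewrite powR_expE//; apply: le_trans (expR_ge1Dx _).
  have : (2 * m + 1) * A <= ln n%:R by near: n; exact: near_ln.
  by rewrite -ler_pdivlMl// => h; apply: le_trans h _; rewrite lerDr.
move=> [g0 p1]; have p0 : 0 < p by lra.
near=> n.
have : Num.max 1 A `^ p <= ln n%:R by near: n; exact: near_ln.
move=> h; apply: (@le_trans _ _ (Num.max 1 A)); first by rewrite le_max lexx orbT.
have m0 : 0 <= Num.max 1 A by rewrite le_max ler01.
have -> : Num.max 1 A = (Num.max 1 A `^ p) `^ p^-1.
  by rewrite -powRrM divff ?gt_eqF// powRr1.
apply: ge0_ler_powR; rewrite ?nnegrE ?powR_ge0 ?invr_ge0 ?(ltW p0)//.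
by apply: le_trans h; exact: powR_ge0.
Unshelve. all: by end_near. Qed.

Lemma near_sketch_size k (s : nat -> nat) (e : R) : summable_decay k ->
  (fun n => (s n)%:R : R) =o_\oo s_dagger k -> 0 < e ->
  \forall n \near \oo, (s n).+1%:R <= e * s_dagger k n.
Proof.
move=> sk /eqoP so e0; have e20 : 0 < e / 2 by rewrite divr_gt0.
near=> n.
have h : `|(s n)%:R : R| <= e / 2 * `|s_dagger k n|.
  by near: n; exact: so.
have h2 : 2 / e <= s_dagger k n by near: n; exact: near_s_dagger.
have sd0 : 0 <= s_dagger k n by apply: le_trans h2; rewrite divr_ge0// ltW.
rewrite normr_nat (ger0_norm sd0) in h.
have : 1 <= e / 2 * s_dagger k n.
  by rewrite -ler_pdivrMl// mulr1 invf_div.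
by move=> h1; rewrite -natr1 [in leRHS](splitr e) mulrDl lerD.
Unshelve. all: by end_near. Qed.

(** Two lower bounds on the exponent [n / q ^ 2], [q = s n + 1]: the first is the
    comparison with [delta_], the second makes it large enough to absorb any power
    of [n]. *)
Lemma near_rates k (s : nat -> nat) : summable_decay k ->
  (fun n => (s n)%:R : R) =o_\oo s_dagger k ->
  exists2 al : R, 0 < al & \forall n \near \oo,
    [/\ (s n).+1%:R ^+ 2 <= n%:R :> R,
        n%:R * delta_ k n <= n%:R / (s n).+1%:R ^+ 2 &
        expR (al * ln n%:R) <= n%:R / (s n).+1%:R ^+ 2].
Proof.
move=> sk so; have qs := near_sketch_size sk so ltr01.
case: k sk so qs => [m|g p] /= sk so qs.
  have m0 : 0 < 2 * m + 1 by lra.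
  have m2 : 0 < 2 * m - 1 by lra.
  pose al := (2 * m - 1) / (2 * m + 1).
  have al0 : 0 < al by rewrite divr_gt0.
  exists al => //; near=> n.
  have n0 : 0 < n%:R :> R by rewrite ltr0n; near: n; exact: nbhs_infty_gt.
  have L0 : 0 <= ln n%:R :> R by near: n; exact: near_ln.
  have q0 : 0 < (s n).+1%:R ^+ 2 :> R by rewrite exprn_gt0.
  have : (s n).+1%:R <= 1 * n%:R `^ (2 * m + 1)^-1 :> R by near: n; exact: qs.
  rewrite mul1r powR_expE// => q.
  have q2 : (s n).+1%:R ^+ 2 <= expR ((2 * m + 1)^-1 * ln n%:R * 2) :> R.
    by rewrite expRM_natr lerXn2r ?nnegrE ?expR_ge0.
  have key : expR (al * ln n%:R) <= n%:R / (s n).+1%:R ^+ 2.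
    rewrite ler_pdivlMr//; apply: (@le_trans _ _ (expR (al * ln n%:R) *
      expR ((2 * m + 1)^-1 * ln n%:R * 2))); first by rewrite ler_pM2l ?expR_gt0.
    rewrite -expRD -[leRHS]lnK ?posrE// ler_expR le_eqVlt; apply/orP; left; apply/eqP.
    by rewrite /al; field; rewrite gt_eqF.
  split=> //.
    have : 1 <= n%:R / (s n).+1%:R ^+ 2 :> R.
      by apply: le_trans key; rewrite -[leLHS]expR0 ler_expR mulr_ge0 ?(ltW al0).
    by rewrite ler_pdivlMr// mul1r.
  apply: le_trans key; rewrite powR_expE// -[X in X * _]lnK ?posrE// -expRD ler_expR.
  rewrite -[X in X + _]mul1r -mulrDl ler_wpM2r//.
  have -> : al = 1 - 2 / (2 * m + 1) by rewrite /al; field; rewrite gt_eqF.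
  by rewrite lerD2l lerN2 ler_pM2l// lef_pV2 ?posrE//; lra.
move: sk => [g0 p1]; have p0 : 0 < p by lra.
exists 2^-1; first by [].
have [L0 hL0] := @exp_dominates (4^-1) 1 ltac:(lra) ltr01.
near=> n.
have n0 : 0 < n%:R :> R by rewrite ltr0n; near: n; exact: nbhs_infty_gt.
have L1 : 1 <= ln n%:R :> R by near: n; exact: near_ln.
have q0 : 0 < (s n).+1%:R ^+ 2 :> R by rewrite exprn_gt0.
have : (s n).+1%:R <= 1 * ln n%:R `^ p^-1 :> R by near: n; exact: qs.
rewrite mul1r => q.
have q2 : (s n).+1%:R ^+ 2 <= ln n%:R `^ (2 / p) :> R.
  rewrite mulrC powRrM powR_mulrn ?powR_ge0//.
  by rewrite lerXn2r ?nnegrE ?powR_ge0.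
have L2 : ln n%:R `^ (2 / p) <= expR (2^-1 * ln n%:R) :> R.
  apply: (@le_trans _ _ (ln n%:R ^+ 2)).
    rewrite -powR_mulrn; last by lra.
    by apply: ler_powR => //; rewrite ler_pdivrMr// ler_peMr.
  have : 1 * (ln n%:R + 1) < expR (4^-1 * ln n%:R) :> R.
    by apply: hL0; near: n; exact: near_ln.
  move=> h; rewrite (_ : 2^-1 * ln n%:R = 4^-1 * ln n%:R * 2); last by field.
  by rewrite expRM_natr lerXn2r ?nnegrE ?expR_ge0//; lra.
have key : expR (2^-1 * ln n%:R) <= n%:R / (s n).+1%:R ^+ 2 :> R.
  rewrite ler_pdivlMr//; apply: (@le_trans _ _ (expR (2^-1 * ln n%:R) *
    expR (2^-1 * ln n%:R))); first by rewrite ler_pM2l ?expR_gt0// (le_trans q2).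
  by rewrite -expRD -mulrDl -[leRHS]lnK ?posrE// ler_expR; lra.
split=> //.
  have : 1 <= n%:R / (s n).+1%:R ^+ 2 :> R.
    by apply: le_trans key; rewrite -[leLHS]expR0 ler_expR mulr_ge0//; lra.
  by rewrite ler_pdivlMr// mul1r.
by rewrite powRN ler_pM2l// lef_pV2 ?posrE ?powR_gt0//; lra.
Unshelve. all: by end_near. Qed.

(** One half of the exponent absorbs the polynomial factor, the other half is the
    bound. *)
Lemma failure_probability_small k (s : nat -> nat) (b : R) : 0 < b -> summable_decay k ->
  (fun n => (s n)%:R : R) =o_\oo s_dagger k ->
  \forall n \near \oo,
    2 * (s n).+1%:R ^+ 2 * expR (- (n%:R / (b * (s n).+1%:R ^+ 2)))
      < expR (- ((2 * b)^-1 * n%:R * delta_ k n)).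
Proof.
move=> b0 sk so; have [al al0 rates] := near_rates sk so.
have b2 : 0 < 2 * b by rewrite mulr_gt0.
have [L0 hL0] := exp_dominates al0 b2.
near=> n.
have n0 : 0 < n%:R :> R by rewrite ltr0n; near: n; exact: nbhs_infty_gt.
have [q2 h1 h2] : [/\ (s n).+1%:R ^+ 2 <= n%:R :> R,
        n%:R * delta_ k n <= n%:R / (s n).+1%:R ^+ 2 &
        expR (al * ln n%:R) <= n%:R / (s n).+1%:R ^+ 2].
  by near: n; exact: rates.
have q0 : 0 < (s n).+1%:R ^+ 2 :> R by rewrite exprn_gt0.
have hL : 2 * b * (ln n%:R + 1) < expR (al * ln n%:R).
  by apply: hL0; near: n; exact: near_ln.
pose a : R := n%:R / (s n).+1%:R ^+ 2.
have -> : n%:R / (b * (s n).+1%:R ^+ 2) = a / (2 * b) + a / (2 * b).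
  by rewrite /a; field; rewrite !gt_eqF.
rewrite opprD expRD mulrA -[ltRHS]mul1r.
apply: (@lt_le_trans _ _ (1 * expR (- (a / (2 * b))))); last first.
  by rewrite !mul1r ler_expR lerN2 -mulrA mulrC ler_pM2r ?invr_gt0.
rewrite ltr_pM2r ?expR_gt0//.
have e1 : 1 + 1 <= expR 1 :> R by exact: expR_ge1Dx.
apply: (@le_lt_trans _ _ (expR 1 * expR (ln n%:R) * expR (- (a / (2 * b))))).
  rewrite ler_pM2r ?expR_gt0// lnK ?posrE//.
  by apply: ler_pM => //; rewrite ?(ltW q0)//; lra.
rewrite -!expRD -[ltRHS]expR0 ltr_expR subr_lt0 ltr_pdivlMr//.
rewrite [1 + _]addrC [_ * (2 * b)]mulrC.
exact: lt_le_trans hL h2.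
Unshelve. all: by end_near. Qed.

Lemma risk_rate k mu (s : nat -> nat) (C : R) : 0 < C -> summable_decay k ->
  has_decay k mu -> (fun n => (s n)%:R : R) =o_\oo s_dagger k ->
  much_larger (fun n => C ^+ 2 / 2 * mu (s n)) (r_dagger k).
Proof.
move=> C0 sk [c [c' [c0 _ hmu]]] so.
pose K := C ^+ 2 / 2 * c.
have K0 : 0 < K by rewrite mulr_gt0// divr_gt0// exprn_gt0.
have Kle n : K * decay_rate k (s n).+1 <= C ^+ 2 / 2 * mu (s n).
  have /andP[h _] := hmu (s n).
  by rewrite /K -mulrA ler_wpM2l// divr_ge0// sqr_ge0.
apply/cvgryPge => A.
pose A' := Num.max 1 A.
have A1 : 1 <= A' by rewrite le_max lexx.
have AA : A <= A' by rewrite le_max lexx orbT.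
case: k sk hmu so Kle => [m|g p] sk hmu so Kle.
  have m0 : 0 < 2 * m by move: sk => /=; lra.
  pose e := (A' / K) `^ (- (2 * m)^-1).
  have AK : 0 < A' / K by rewrite divr_gt0// (lt_le_trans ltr01).
  have e0 : 0 < e by rewrite powR_gt0.
  have qs := near_sketch_size sk so e0.
  near=> n; apply: le_trans AA _.
  have n0 : 0 < n%:R :> R by rewrite ltr0n; near: n; exact: nbhs_infty_gt.
  have q : (s n).+1%:R <= e * s_dagger (PDK m) n :> R by near: n; exact: qs.
  have r0 : 0 < r_dagger (PDK m) n by rewrite /= powR_gt0.
  rewrite ler_pdivlMr//; apply: le_trans (Kle n).
  rewrite -ler_pdivrMl// mulrA [_^-1 * _]mulrC.
  have -> : A' / K * r_dagger (PDK m) n = (e * s_dagger (PDK m) n) `^ (- (2 * m)).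
    rewrite powRM ?(ltW e0)//= ?powR_ge0// /e -!powRrM mulrNN mulVf ?gt_eqF//.
    by rewrite (powRr1 (ltW AK)) mulrN; congr (_ * _ `^ (- _)); exact: mulrC.
  have sd0 : 0 < s_dagger (PDK m) n by rewrite /= powR_gt0.
  rewrite [decay_rate _ _]/= !powRN lef_pV2 ?posrE ?powR_gt0 ?mulr_gt0//.
  by apply: ge0_ler_powR => //; rewrite ?nnegrE ?(ltW m0)// mulr_ge0 ?(ltW e0) ?(ltW sd0).
move: (sk) => [g0 p1]; have p0 : 0 < p by lra.
pose e := (2 * g)^-1 `^ p^-1.
have g2 : 0 < (2 * g)^-1 by rewrite invr_gt0 mulr_gt0.
have e0 : 0 < e by rewrite powR_gt0.
have qs := near_sketch_size sk so e0.
have [L0 hL0] := @exp_dominates (4^-1) (A' / K) ltac:(lra) (divr_gt0 (lt_le_trans ltr01 A1) K0).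
near=> n; apply: le_trans AA _.
have n0 : 0 < n%:R :> R by rewrite ltr0n; near: n; exact: nbhs_infty_gt.
have q : (s n).+1%:R <= e * s_dagger (EDK g p) n :> R by near: n; exact: qs.
have L_ge1 : 1 <= ln n%:R :> R by near: n; exact: near_ln.
have hA : A' / K * (ln n%:R + 1) < expR (4^-1 * ln n%:R).
  by apply: hL0; near: n; exact: near_ln.
set L := ln n%:R in q L_ge1 hA.
have L0' : 0 < L by lra.
have Lp : L `^ p^-1 <= L by rewrite ler1_powR// invf_le1.
have r0 : 0 < r_dagger (EDK g p) n.
  by rewrite /= -/L mulr_gt0 ?invr_gt0// powR_gt0.
rewrite ler_pdivlMr//; apply: le_trans (Kle n).
rewrite -ler_pdivrMl// mulrA [_^-1 * _]mulrC.
have rate : expR (- (2^-1 * L)) <= decay_rate (EDK g p) (s n).+1.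
  rewrite /= ler_expR lerN2.
  have : (s n).+1%:R `^ p <= (2 * g)^-1 * L.
    apply: (@le_trans _ _ ((e * s_dagger (EDK g p) n) `^ p)).
      apply: ge0_ler_powR => //; rewrite ?nnegrE ?(ltW p0)//.
      by rewrite mulr_ge0 ?(ltW e0)// powR_ge0.
    rewrite powRM ?(ltW e0)//= ?powR_ge0// /e -!powRrM mulVf ?gt_eqF//.
    by rewrite (powRr1 (ltW g2)) (powRr1 (ltW L0')).
  move=> h; apply: (@le_trans _ _ (g * ((2 * g)^-1 * L))); first by rewrite ler_pM2l.
  by rewrite mulrA invfM mulrCA divff ?gt_eqF// mulr1.
apply: le_trans rate.
rewrite /= -/L.
apply: (@le_trans _ _ (expR (4^-1 * L) * n%:R^-1)).
  rewrite mulrA ler_wpM2r// (le_trans _ (ltW hA))//.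
  apply: ler_wpM2l; first by rewrite divr_ge0 ?(ltW K0)//; lra.
  by lra.
rewrite -[n%:R]lnK ?posrE// -/L -expRN -expRD ler_expR; lra.
Unshelve. all: by end_near. Qed.

End Asymptotics.

(** * The main theorem *)

Section Events.
Context {R : realType} {d : measure_display} {Omega : measurableType d}.
Variable P : probability Omega R.

Lemma event_type_sure d1 (T1 : measurableType d1) (V : Omega -> T1) a b E :
  measurable_fun setT V -> (forall w, E w) -> event_type P V a b E.
Proof.
move=> mV EE; exists setT, (fun=> 1); split=> //.
  split=> // B mB; have mVB : measurable (V @^-1` B).
    by rewrite -[X in measurable X]setTI; exact: mV.
  by rewrite integral_cst// mul1e setIT.
have e1 (x : \bar R) : (1 - expeR x <= 1)%E.
  by rewrite -[leRHS]adde0 leeD2l// oppe_le0 expeR_ge0.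
rewrite (_ : [set w | _] = setT) ?probability_setT//.
by apply/seteqP; split=> // w _ /=; exact: e1.
Qed.

(** The lower bound [1 - expeR 0] on the probability is zero. *)
Lemma event_type_vacuous d1 (T1 : measurableType d1) (V : Omega -> T1) a E :
  event_type P V a 0 E.
Proof.
exists set0, (fun=> 0); split=> //.
  by split=> // B mB; rewrite setI0 measure0 integral0.
by rewrite oppe0 expeR0 subee// measure_ge0.
Qed.

(** The lower bound is negative, so that the empty event qualifies. *)
Lemma prob_gt_vacuous (a : R) (b : \bar R) E :
  0 < a -> (0 <= b)%E -> prob_gt P (1 - a%:E - b - 1)%E E.
Proof.
move=> a0 b0; exists set0; split=> //; rewrite measure0.
by case: b b0 => [r| |]// r0; rewrite -!EFinB lte_fin; rewrite lee_fin in r0; lra.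
Qed.

Lemma prob_gt_complement (F E : set Omega) (p a : R) (b c : \bar R) :
  measurable F -> F `<=` E -> (P (~` F) <= p%:E)%E -> p < a ->
  (0 <= b)%E -> (0 <= c)%E -> prob_gt P (1 - a%:E - b - c)%E E.
Proof.
move=> mF FE Fp pa b0 c0; exists F; split=> //.
have PF : P F = (1 - P (~` F))%E.
  by rewrite -[in LHS](setCK F) probability_setC//; exact: measurableC.
have fF : P (~` F) \is a fin_num by apply: fin_num_measure; exact: measurableC.
rewrite PF -(fineK fF); rewrite -(fineK fF) lee_fin in Fp.
by case: b b0 => [r| |]//; case: c c0 => [t| |]//;
  rewrite ?lee_fin -?EFinB ?lte_fin ?ltNyr//; lra.
Qed.

End Events.

Section SampleSketch.
Context {R : realType} {d dT : measure_display}.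
Context {Omega : measurableType d} {T : measurableType dT}.
Variables (P : probability Omega R) (PX : probability T R).
Variables (X : nat -> {RV P >-> T}) (eps : nat -> {RV P >-> R}).
Hypothesis hdata : regression_data PX X eps.

(** A sketch that is a measurable function of the design inherits the
    independence of the design from the noise. *)
Lemma sample_sketch_random n s (g : n.-tuple T -> 'M[rat]_(s, n)) :
  (forall C, measurable (g @^-1` C)) ->
  random_sketch P X eps (fun w => map_mx ratr (g (sample X n w)) : 'M[R]_(s, n)).
Proof.
move=> mg.
have mgij i j : measurable_fun setT (fun v => (map_mx ratr (g v) : 'M[R]_(s, n)) i j).
  move=> _ B mB; rewrite setTI.
  exact: (mg [set Q | B ((map_mx ratr Q : 'M[R]_(s, n)) i j)]).
have mX := measurable_sample X (n := n).
split=> [i j|A B mA mB].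
  exact: (measurableT_comp (mgij i j) mX).
pose h v := (v, mx_tuple (map_mx ratr (g v) : 'M[R]_(s, n))).
have mh : measurable_fun setT h.
  apply: measurable_fun_pair => //.
  apply/measurable_fun_tnthP => i; apply/measurable_fun_tnthP => j.
  rewrite (_ : _ \o _ = fun v => (map_mx ratr (g v) : 'M[R]_(s, n)) i j)//.
  by apply/funext => v /=; rewrite !tnth_mktuple.
have mB' : measurable (h @^-1` B).
  by rewrite -[X in measurable X]setTI; exact: mh.
have := data_indep hdata mB' mA.
by rewrite setIC muleC.
Qed.

End SampleSketch.

Theorem theorem4p13 (R : realType) (dim : nat) (hdim : (0 < dim)%N)
  (D : set (dim.-tuple R)) (mD : measurable D)
  (PX : probability (dim.-tuple R) R) (PXD : PX D = 1%E)
  (H : set (dim.-tuple R -> R))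
  (ip : (dim.-tuple R -> R) -> (dim.-tuple R -> R) -> R)
  (K : dim.-tuple R -> dim.-tuple R -> R)
  (mu : nat -> R) (phi : nat -> dim.-tuple R -> R)
  (hH : rkhs D H ip K) (hL2 : forall f, H f -> f \in Lfun PX 2%:E)
  (hK : eigensystem PX D H ip K mu phi) (hA1 : assumption_A1 mu phi)
  (k : decay R) (hk : decay_valid k) (hmu : has_decay k mu)
  (d : measure_display) (Omega : measurableType d) (P : probability Omega R)
  (X : nat -> {RV P >-> dim.-tuple R}) (eps : nat -> {RV P >-> R})
  (hdata : regression_data PX X eps)
  (C : R) (hC : 0 < C) :
  exists2 d0 : R, 0 < d0 & forall dc : R, d0 <= dc ->
  forall (s : nat -> nat) (lam : nat -> R),
    (fun n => (s n)%:R : R) =o_\oo s_dagger k ->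
    (forall n, (0 < n)%N -> 0 < lam n) ->
    (forall n, (0 < n)%N -> dc * (s_lambda mu (lam n))%:R <= (s n)%:R) ->
  exists (S : forall n, Omega -> 'M[R]_(s n, n)) (c1 c2 : \bar R),
    [/\ forall n, (0 < n)%N -> random_sketch P X eps (S n),
        assumption_A2 P K mu X dc c1 c2 lam S
      & exists2 c : R, 0 < c &
        exists2 t : nat -> R, much_larger t (r_dagger k) &
        \forall n \near \oo,
          prob_gt P
            (1 - expeR (- (c * n%:R * delta_ k n)%:E)
               - expeR (- (c1 * (s n)%:R%:E))
               - expeR (- (c2 * (s_lambda mu (lam n))%:R%:E)))%E
            [set w | normal_matrix K (sample X n w) (lam n) (S n w) \in unitmx
              /\ ((t n)%:E <= worst_risk K (sample X n w) (hball H ip C)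
                                (lam n) (S n w) (sample eps n w))%E]].
Proof.
have [[M phiM] [M1 tailM]] := hA1.
have mu_gt0 := has_decay_gt0 hmu.
have kernelE := eigen_kernel hK.
have [phiL phi_orth _] := eigen_basis hK.
have mphi i : measurable_fun setT (phi i).
  by have := sub_Lfun_mfun (phiL i); rewrite inE.
have sk := has_decay_summable hk hmu tailM.
pose d0 := sketch_factor M M1.
have d00 : 0 < d0 by apply: lt_le_trans (sketch_factor_ge2 M mu_gt0 tailM).
exists d0 => // dc d0c s lam so lam0 hs.
have hs0 n : (0 < n)%N -> d0 * (s_lambda mu (lam n))%:R <= (s n)%:R.
  by move=> n0; apply: le_trans (hs n n0); rewrite ler_wpM2r.
have /(_ _)/cid-/all_sig[g gP] n : exists g : n.-tuple (dim.-tuple R) -> 'M[rat]_(s n, n),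
    (forall A, measurable (g @^-1` A)) /\
    ((0 < n)%N -> (0 < s_lambda mu (lam n))%N -> forall v,
      let S : 'M[R]_(s n, n) := map_mx ratr (g v) in
      good_sketch (gram K v) (lam n) S /\
      (good_design phi (s n).+1 v -> normal_matrix K v (lam n) S \in unitmx)).
  have [/andP[n0 k0]|nk] := boolP ((0 < n)%N && (0 < s_lambda mu (lam n))%N).
    have [g [mg gg]] := exists_measurable_sketch kernelE mphi mu_gt0 phiM tailM n
      (lam0 n n0) k0 (hs0 n n0).
    by exists g; split.
  exists (fun=> 0); split=> [A|n0 k0]; last by rewrite n0 k0 in nk.
  by rewrite preimage_cst; case: ifP.
pose S n (w : Omega) : 'M[R]_(s n, n) := map_mx ratr (g n (sample X n w)).
exists S, +oo%E, +oo%E; split.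
- by move=> n _; apply: (sample_sketch_random hdata); exact: (gP n).1.
- split=> //; exists 2 => // n n0.
  have [k0|k0] := posnP (s_lambda mu (lam n)).
    by rewrite k0 mule0; exact: event_type_vacuous.
  apply: event_type_sure; first exact: measurable_sample.
  move=> w /=; have [gs _] := (gP n).2 n0 k0 (sample X n w).
  apply: good_sketch_satisfiable gs; first exact: lam0.
    exact: (gram_sym kernelE).
  by apply: (gram_psd _ kernelE) => i; exact: ltW.
(* The constant that Hoeffding's inequality gives for products of two features. *)
pose b := 32 * (M ^+ 2 + 1) ^+ 2.
have b0 : 0 < b by rewrite mulr_gt0// exprn_gt0// ltr_wpDl// sqr_ge0.
exists (2 * b)^-1; first by rewrite invr_gt0 mulr_gt0.
exists (fun n => C ^+ 2 / 2 * mu (s n)); first exact: risk_rate hC sk hmu so.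
near=> n.
have n0 : (0 < n)%N by near: n; exact: nbhs_infty_gt.
have [k0|k0] := posnP (s_lambda mu (lam n)).
  rewrite k0 mule0 oppe0 expeR0; apply: prob_gt_vacuous; first exact: expR_gt0.
  exact: expeR_ge0.
pose G := [set v : n.-tuple (dim.-tuple R) | good_design phi (s n).+1 v].
apply: (prob_gt_complement (F := sample X n @^-1` G)).
- rewrite -[X in measurable X]setTI.
  exact: (measurable_sample X measurableT (measurable_good_design mphi (s n).+1 (n := n))).
- move=> w /= gd; split; first exact: ((gP n).2 n0 k0 (sample X n w)).2 gd.
  apply: (worst_risk_ge hH mu_gt0 _ _ _ kernelE) => //.
  + exact: (eigen_ordered hK).
  + by move=> i; exact: (eigen_mem hK).
  + by move=> i j; exact: (eigen_ip hK).
- exact: (good_design_prob (data_design hdata) mphi phiM phi_orth n (ltn0Sn (s n))).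
- by near: n; exact: (failure_probability_small b0 sk so).
- exact: expeR_ge0.
- exact: expeR_ge0.
Unshelve. all: by end_near. Qed.
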